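(* Assume $\mu^*<1$. Let the arms be played according to the DMED policy with parameter $r\in(0,1)$. Let $\varepsilon\in(0,1)$ and $i\notin\mathcal{I}_{\mathrm{opt}}$ be arbitrary, and fix any $\delta\in(0,\mu^*-\mu')$ such that $$\xi_{i,\varepsilon,\delta}:=\varepsilon D_{\inf}(F_i,\mu^* )-\frac{\delta}{1-\mu^*}>0 .$$ Then for all $n>0$ $$\mathrm{E}[T_i(n)]\le\frac{\log n}{(1-\varepsilon)(1-r)D_{\inf}(F_i,\mu^* )}+C,$$ where $$\begin{aligned}C=\ &\frac{1}{1-e^{-\tilde\Lambda^*(\xi_{i,\varepsilon,\delta},\,\mu_i,\,\mu^* )}}+\sum_{k\in\mathcal{I}_{\mathrm{opt}}}\frac{K}{1-e^{-\Lambda_k^*(\mu^*-\delta)}}+\sum_{k\notin\mathcal{I}_{\mathrm{opt}}}\frac{K}{1-e^{-\Lambda_k^*(\mu'+\delta)}}\\&+\min_{k\in\mathcal{I}_{\mathrm{opt}}}\left\{\frac{2(1+K)}{1-e^{-\Lambda_k^*(\mu'+\delta)}}+\frac{2e}{r\left(1-e^{-r\Lambda_k^*(\mu'+\delta)}\right)^2}\right\}.\end{aligned}$$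
   Context: Bandit model. $\mathcal{A}$ is the family of all probability distributions on $(-\infty,1]$. There are $K$ arms; the rewards of arm $i\in\{1,\dots,K\}$ are an i.i.d. sequence from $F_i\in\mathcal{A}$ with mean $\mu_i$, where the moment generating function $\mathrm{E}_{F_i}[e^{\lambda X}]$ is finite in some neighborhood of $\lambda=0$. At each round one arm is pulled. $\mu^*=\max_i\mu_i$, $\mathcal{I}_{\mathrm{opt}}=\{i:\mu_i=\mu^*\}$, and $\mu'=\max_{i\notin\mathcal{I}_{\mathrm{opt}}}\mu_i$. $T_i(n)$ is the number of times arm $i$ has been pulled through the first $n$ rounds; $\hat F_i(n)$ and $\hat\mu_i(n)$ are the empirical distribution and empirical mean of the rewards obtained from arm $i$ in the first $n$ rounds; $\hat\mu^*(n)=\max_i\hat\mu_i(n)$. Divergence. $D_{\inf}(F,\mu)=\inf_{G\in\mathcal{A}:\,\mathrm{E}(G)>\mu}D(F\Vert G)$, where $D(\cdot\Vert\cdot)$ is the Kullback-Leibler divergence and $\mathrm{E}(G)$ is the mean of $G$. DMED policy with parameter $r\in(0,1)$. Let $J'_n(j)$ be the event $\{(1-r)T_j(n)D_{\inf}(\hat F_j(n),\hat\mu^*(n))\le\log n\}$. Initialization: pull each arm once; set $n:=K$, $L_C:=L_R:=\{1,\dots,K\}$, $L_N:=\emptyset$. Then loop: for each $i\in L_C$ in ascending order, (1) set $n:=n+1$, pull arm $i$, and set $L_R:=L_R\setminus\{i\}$; (2) set $L_N:=L_N\cup\{j\}$ for every $j\notin L_R$ such that $J'_n(j)$ occurs.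 After all $i\in L_C$ have been processed, set $L_C:=L_R:=L_N$ and then $L_N:=\emptyset$. Rate functions. $\Lambda_k^*(x)=\sup_{\lambda\in\mathbb{R}}\{\lambda x-\log\mathrm{E}_{F_k}[e^{\lambda X}]\}$. For a fixed constant $c_0\ge 2.163$, and $v>0$, $m<\mu<1$, $$\tilde\Lambda^*(v,m,\mu)=\begin{cases}\dfrac{v^2}{2\left(c_0+\frac{1-m}{1-\mu}\right)}, & v\le\frac12\left(c_0+\frac{1-m}{1-\mu}\right),\\[2mm] \dfrac v2-\dfrac18\left(c_0+\frac{1-m}{1-\mu}\right), & \text{otherwise.}\end{cases}$$ *)

(* Defs.v *)
From HB Require Import structures.
From mathcomp Require Import all_boot all_order all_algebra.
From mathcomp Require Import all_classical all_reals all_analysis.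

Set Implicit Arguments.
Unset Strict Implicit.
Unset Printing Implicit Defensive.

Import Order.TTheory GRing.Theory Num.Theory.
Import numFieldNormedType.Exports.

Local Open Scope classical_set_scope.
Local Open Scope ring_scope.

(* The family A of distributions on (-oo, 1]: arbitrary Borel probability
   measures on R that give full mass to (-oo, 1]. *)
Definition semibounded (R : realType) (F : probability R R) : Prop :=
  F `]-oo, 1]%classic = 1%E.

(* Extended-real valued: the positive part of a distribution on (-oo, 1] is
   integrable, so the mean always exists but may be -oo. *)
Definition emean (R : realType) (F : probability R R) : \bar R :=
  (\int[F]_x x%:E)%E.

Definition mean (R : realType) (F : probability R R) : R := fine (emean F).

Section divergence.
Context (R : realType).
Local Open Scope ereal_scope.
Local Open Scope charge_scope.

(* The first argument is only required to be a finite measure so that the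
   empirical measure below, which is 0 when there is no sample, can be used
   without a side condition; on probabilities this is the Kullback-Leibler
   divergence. *)
Definition kl (F : {finite_measure set R -> \bar R})
    (G : probability R R) : \bar R :=
  if `[< F `<< G >] then
    \int[F]_x lne (('d (charge_of_finite_measure F) '/d G) x)
  else +oo.

Definition Dinf (F : {finite_measure set R -> \bar R}) (mu : R) : \bar R :=
  ereal_inf [set kl F G | G in
    [set G : probability R R | semibounded G /\ mu%:E < emean G]].

End divergence.

Section rates.
Context (R : realType).

Definition mgf (F : probability R R) (l : R) : \bar R :=
  (\int[F]_x (expR (l * x))%:E)%E.

Definition mgf_finite_near0 (F : probability R R) : Prop :=
  exists2 eta : R, 0 < eta &
    forall l : R, `|l| < eta -> (mgf F l < +oo)%E.

(* Where the moment generating function is +oo the bracket is -oo, hence does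
   not contribute to the supremum. *)
Definition cramer (F : probability R R) (x : R) : \bar R :=
  ereal_sup [set ((l * x)%:E - lne (mgf F l))%E | l in [set: R]].

Definition tcramer (c0 v m mu : R) : R :=
  let c := c0 + (1 - m) / (1 - mu) in
  if v <= c / 2 then v ^+ 2 / (2 * c) else v / 2 - c / 8.

Definition expeN (x : \bar R) : R := fine (expeR (- x)%E).

End rates.

(* Maximum over a nonempty finite index set (0 if A is empty). *)
Definition maxin (R : realType) (K : nat) (A : {set 'I_K}) (f : 'I_K -> R) : R :=
  fine (\big[maxe/-oo%E]_(i in A) (f i)%:E).

Definition mustar (R : realType) (K : nat) (mu : 'I_K -> R) : R :=
  maxin [set: 'I_K]%SET mu.

Definition Iopt (R : realType) (K : nat) (mu : 'I_K -> R) : {set 'I_K} :=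
  [set i | mu i == mustar mu]%SET.

Definition muprime (R : realType) (K : nat) (mu : 'I_K -> R) : R :=
  maxin (~: Iopt mu)%SET mu.

Section empirical.
Context (R : realType) (x : nat -> R) (t : nat).

Definition empmean : R := (\sum_(s < t) x s) / t%:R.

Definition empirical : set R -> \bar R :=
  mscale (t%:R^-1)%:nng (msum (fun s => \d_(x s)) t).

HB.instance Definition _ := Measure.on empirical.

Let empirical_fin : fin_num_fun empirical.
Proof.
move=> A mA; rewrite /empirical /mscale /msum fin_numM//.
by apply/sum_fin_numP => s _ _; exact: fin_num_measure.
Qed.

HB.instance Definition _ :=
  Measure_isFinite.Build _ _ _ empirical empirical_fin.

End empirical.

Section policy.
Context (R : realType) (K : nat) (r : R).

(* Rewards come from stacks: x j s is what arm j yields at its (s+1)-st pull.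
   Hence, when arm j has been pulled T j times, its observed rewards are
   x j 0, ..., x j (T j - 1). *)
Implicit Types (x : 'I_K -> nat -> R) (T : 'I_K -> nat) (n : nat).

Definition best_empmean x T : R :=
  maxin [set: 'I_K]%SET (fun j => empmean (x j) (T j)).

Definition J' x T n (j : 'I_K) : bool :=
  (((1 - r) * (T j)%:R)%:E * Dinf (empirical (x j) (T j)) (best_empmean x T)
     <= (ln n%:R)%:E)%E.

(* L_C is not stored: L_R is exactly the part of L_C that has not been
   processed yet, and L_C is reset together with L_R. *)
Record state := State {
  LR : {set 'I_K};
  LN : {set 'I_K};
  pulls : 'I_K -> nat }.

(* Effect of pulling arm i in round n. *)
Definition dmed_round x n (i : 'I_K) (st : state) : state :=
  let T j := (pulls st j + (j == i))%N in
  let LR' := (LR st :\ i)%SET in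
  let LN' := (LN st :|: [set j | (j \notin LR') && J' x T n j])%SET in
  if LR' == finset.set0 then State LN' finset.set0 T else State LR' LN' T.

(* State after K + m rounds. As enum lists 'I_K in increasing order, the head
   of enum LR is the next arm of the loop over L_C in ascending order.

   A loop can end with L_N empty (this requires an empirical mean equal to 1:
   then Dinf is an infimum over the empty set, +oo); the policy then loops over
   an empty list for ever, no further arm is pulled, and the state is frozen. *)
Fixpoint dmed_loop x m : state :=
  if m is m'.+1 then
    let st := dmed_loop x m' in
    if enum (LR st) is i :: _ then dmed_round x (K + m) i st else st
  else State [set: 'I_K]%SET finset.set0 (fun=> 1%N).

(* T_i(n), the arms being pulled in the order 0, ..., K - 1 in the first K
   rounds. *)
Definition dmed_pulls x n (i : 'I_K) : nat :=
  if (n <= K)%N then nat_of_bool (i < n)%N else pulls (dmed_loop x (n - K)) i.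

End policy.

Definition mutually_independent d (T : measurableType d) (R : realType)
    (P : probability T R) (Y : nat -> {RV P >-> R}) : Prop :=
  forall (J : seq nat) (B : nat -> set R), uniq J ->
    (forall s, measurable (B s)) ->
    P (\bigcap_(s in [set` J]) (Y s @^-1` B s)) =
      (\prod_(s <- J) P (Y s @^-1` B s))%E.

Definition iid_with_law d (T : measurableType d) (R : realType)
    (P : probability T R) (Y : nat -> {RV P >-> R}) (F : probability R R) : Prop :=
  mutually_independent Y /\
  forall s (A : set R), measurable A -> distribution P (Y s) A = F A.

(* Main.v *)
Require Import Defs.
From HB Require Import structures.
From mathcomp Require Import all_boot all_order all_algebra.
From mathcomp Require Import all_classical all_reals all_analysis.
From mathcomp Require Import measurable_realfun.
From mathcomp Require Import zify ring lra.

(** Why the bound holds.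

    An arm is pulled only when it is listed for the current loop, so up to the two
    initial pulls T_i(n) is the number of insertions of i into the list of the next
    loop ([pulls_le_insertions]).  At an insertion of i the best empirical mean falls
    into one of three ranges, and every range is counted by numbers of pulls instead
    of rounds ([dmed_pulls_le]).

    - It is at least mu* - delta.  Then the test for i succeeds against the mean
      mu* - delta.  At most log n / ((1 - eps) (1 - r) D) values t of T_i allow this
      with an empirical Dinf of at least (1 - eps) D; the other values require a
      deviation of the empirical Dinf of arm i below its true value, which has
      exponentially small probability ([Dinf_deviation]).

    - It is smaller, but attained by an optimal arm k, or by a suboptimal arm k with
      empirical mean at least mu' + delta.  The mean of arm k is then
      misleading, an event controlled by the Cramer transform ([chernoff_lower],
      [chernoff_upper]).  The best arm always passes its own test ([J'_best]), so it is
      pulled soon and, for each value of T_k, this happens at most twice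
      ([insertions_listed_pulls]).

    - It is below mu' + delta.  Then any optimal arm k is underestimated.  If k passes
      its test, it is pulled soon, as above.  If it fails, the round number n is less
      than exp ((1 - r) T_k Dinf), which may be large but whose expectation on the
      event of underestimation is at most 2 e (T_k + 1) exp (- r T_k Lambda)
      ([expectation_grid_powR]).

    Everything about Dinf rests on its dual description as the largest expected
    logarithm of 1 - nu (X - mu) over 0 <= nu <= 1 / (1 - mu), the growth rate of the
    wealth of a gambler in a game that is fair for mean mu.  The bound of Dinf by the growth
    ([Dinf_duality]) comes from tilting F by the inverse of the wealth, with the
    missing mass put at the reward 1.  The converse is used for empirical
    distributions only ([Dinf_empirical_ge]); it turns a small empirical Dinf into a
    small sum of independent terms.  For a large empirical Dinf, the best wealth in
    hindsight is at most e times the sum of the wealths over a grid of t + 2 stakes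
    ([prod_wealth_le_grid]), each of which has expectation at most 1.

    The geometric series over t of these bounds give the terms of the constant.  The
    two factors of the last one combine as exp (- r t Lambda) by interpolating between
    the probability of underestimation and the expectation of the grid wealth. *)

Set Implicit Arguments.
Unset Strict Implicit.
Unset Printing Implicit Defensive.

Import Order.TTheory GRing.Theory Num.Theory.
Import numFieldNormedType.Exports.

Local Open Scope classical_set_scope.
Local Open Scope ring_scope.

(** * Measures with a density *)

Section density.
Context d (T : measurableType d) (R : realType).
Variables (mu : {measure set T -> \bar R}) (phi : T -> R).
Hypotheses (mphi : measurable_fun setT phi) (phi0 : forall x, 0 <= phi x).

(** The proofs are arguments of the definition so that its measure structure can be
    inferred. *)
Definition mdensity of measurable_fun setT phi & (forall x, 0 <= phi x) :=
  fun A : set T => (\int[mu]_(x in A) (phi x)%:E)%E.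

Local Notation nu := (mdensity mphi phi0).

Let nu0 : nu set0 = 0%E.
Proof. exact: integral_set0. Qed.

Let nu_ge0 A : (0 <= nu A)%E.
Proof. by apply: integral_ge0 => x _; rewrite lee_fin. Qed.

Let nu_sigma_additive : semi_sigma_additive nu.
Proof.
move=> F mF tF mUF; rewrite /mdensity ge0_integral_bigcup//.
- by apply: is_cvg_ereal_nneg_natsum => n _; apply: nu_ge0.
- by apply/measurable_EFinP; exact: measurable_funTS.
- by move=> x _; rewrite lee_fin.
Qed.

HB.instance Definition _ :=
  isMeasure.Build _ _ _ nu nu0 nu_ge0 nu_sigma_additive.

Import HBNNSimple.

Lemma ge0_integral_mdensity (f : T -> R) :
  measurable_fun setT f -> (forall x, 0 <= f x) ->
  (\int[nu]_x (f x)%:E = \int[mu]_x (f x * phi x)%:E)%E.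
Proof.
move=> mf f0.
have mEf : measurable_fun setT (EFin \o f) by exact/measurable_EFinP.
pose h := nnsfun_approx measurableT mEf.
have ndh x m n : (m <= n)%N -> h m x <= h n x.
  by move=> mn; exact/lefP/nd_nnsfun_approx.
have cvgh x : (h n x)%:E @[n --> \oo] --> (f x)%:E.
  by apply: (cvg_nnsfun_approx _ mEf) => // y _; rewrite lee_fin.
have -> : (\int[nu]_x (f x)%:E =
    limn (fun n => \int[nu]_x (h n x)%:E))%E.
  rewrite -monotone_convergence//.
  - by apply: eq_integral => x _; apply/esym/cvg_lim.
  - by move=> n; exact/measurable_EFinP.
  - by move=> n x _; rewrite lee_fin.
  - by move=> x _ m n mn; rewrite lee_fin ndh.
have -> : (\int[mu]_x (f x * phi x)%:E =
    limn (fun n => \int[mu]_x (h n x * phi x)%:E))%E.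
  rewrite -monotone_convergence//.
  - apply: eq_integral => x _; apply/esym/cvg_lim => //.
    rewrite EFinM; under eq_fun do rewrite EFinM.
    by apply: cvgeZr => //; exact: cvgh.
  - by move=> n; apply/measurable_EFinP; exact: measurable_funM.
  - by move=> n x _; rewrite lee_fin mulr_ge0.
  - by move=> x _ m n mn; rewrite lee_fin ler_wpM2r// ndh.
congr (limn _); apply/funext => n.
have hE x : (h n x)%:E = (\sum_(y \in range (h n))
    (y * \1_(h n @^-1` [set y]) x)%:E)%E.
  by rewrite fsumEFin// -fimfunE.
under [LHS]eq_integral do rewrite hE.
rewrite ge0_integral_fsum//; last 2 first.
- by move=> y; apply/measurable_EFinP; exact: measurable_funM.
- by move=> y x _; exact: nnfun_muleindic_ge0.
under [RHS]eq_integral => x _.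
  rewrite EFinM hE ge0_mule_fsuml; last first.
    by move=> y; exact: nnfun_muleindic_ge0.
  over.
rewrite [RHS]ge0_integral_fsum//; last 2 first.
- move=> y; apply: emeasurable_funM; apply/measurable_EFinP => //.
  exact: measurable_funM.
- by move=> y x _; apply: mule_ge0; [exact: nnfun_muleindic_ge0|rewrite lee_fin].
apply: eq_fsbigr => y /[!inE] -[x _ <-].
have mA : measurable (h n @^-1` [set h n x]) by [].
rewrite integralZl_indic_nnsfun// integral_indic// setIT.
under [RHS]eq_integral do rewrite EFinM -muleA.
rewrite ge0_integralZl//; last 3 first.
- by apply: emeasurable_funM; apply/measurable_EFinP.
- by move=> z _; rewrite mule_ge0 ?lee_fin.
- by rewrite lee_fin.
congr (_ * _)%E; rewrite [LHS]/= /mdensity integral_mkcond.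
by apply: eq_integral => z _; rewrite muleC epatch_indic.
Qed.

End density.

Lemma integral_cst1 d (T : measurableType d) (R : realType)
    (m : {measure set T -> \bar R}) (m1 : m setT = 1%E) (k : R) :
  (\int[m]_x k%:E = k%:E)%E.
Proof.
transitivity (\int[m]_x cst k%:E x)%E; first by [].
by rewrite integral_cst// m1 mule1.
Qed.

(** * Products of independent rewards *)

Section independence.
Context d (T : measurableType d) (R : realType) (P : probability T R).
Variables (Y : nat -> {RV P >-> R}) (F : probability R R).
Hypothesis iidY : iid_with_law Y F.

Let prod_indicators (J : seq nat) (B : nat -> set R) : uniq J ->
  (forall s, measurable (B s)) ->
  (\int[P]_w (\prod_(s <- J) \1_(B s) (Y s w))%:E =
    (\prod_(s <- J) fine (F (B s)))%:E)%E.
Proof.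
move=> uJ mB; case: iidY => indep law.
have mYB s : measurable (Y s @^-1` B s).
  by rewrite -[_ @^-1` _]setTI; exact: measurable_funP.
transitivity (P (\bigcap_(s in [set` J]) (Y s @^-1` B s))); last first.
  rewrite indep// -prodEFin; apply: eq_bigr => s _.
  by rewrite fineK ?fin_num_measure// -(law s).
have mcap : measurable (\bigcap_(s in [set` J]) (Y s @^-1` B s)).
  by apply: fin_bigcap_measurable => //; exact: finite_seq.
rewrite -[in RHS](setIT (\bigcap_(_ in _) _)) -integral_indic//.
apply: eq_integral => w _; congr EFin.
elim: J {uJ mcap} => [|s J IH].
  by rewrite big_nil indicE mem_set.
rewrite big_cons IH !indicE -natrM; congr (_%:R).
rewrite mulnb; congr nat_of_bool; apply/idP/idP.
  move=> /andP[] /[!inE] Bs BJ s' /=; rewrite inE => /orP[/eqP ->//|s'J].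
  exact: BJ.
move=> /[!inE] BJ; apply/andP; rewrite !inE; split.
  by apply: BJ; rewrite /= mem_head.
by move=> s' /= s'J; apply: BJ; rewrite /= inE s'J orbT.
Qed.

(** Independence is only known for events, so the factors g s are introduced one
    at a time while the others remain indicators.  With the other factors frozen
    into a density, the law of Y s under the reweighted measure agrees with a
    multiple of F on every Borel set, hence integrates g s in the same way. *)
Lemma integral_prod_iid (g : nat -> R -> R) (e : nat -> R) (t : nat) :
  (forall s, measurable_fun setT (g s)) -> (forall s x, 0 <= g s x) ->
  (forall s, \int[F]_x (g s x)%:E = (e s)%:E)%E ->
  (\int[P]_w (\prod_(s < t) g s (Y s w))%:E = (\prod_(s < t) e s)%:E)%E.
Proof.
move=> mg g0 ge.
have e0 s : 0 <= e s.
  by rewrite -lee_fin -ge integral_ge0// => x _; rewrite lee_fin.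
(* J indexes the factors that are already functions, J' the indicators. *)
suff hybrid (J J' : seq nat) (B : nat -> set R) : uniq (J ++ J') ->
    (forall s, measurable (B s)) ->
    (\int[P]_w ((\prod_(s <- J) g s (Y s w)) *
                (\prod_(s <- J') \1_(B s) (Y s w)))%:E =
      ((\prod_(s <- J) e s) * (\prod_(s <- J') fine (F (B s))))%:E)%E.
  have := hybrid (iota 0 t) [::] (fun=> setT).
  rewrite cats0 iota_uniq => /(_ isT (fun=> measurableT)).
  rewrite big_nil mulr1.
  under eq_integral do rewrite big_nil mulr1.
  rewrite -[in LHS](subn0 t) -[in RHS](subn0 t) -/(index_iota 0 t).
  by rewrite big_mkord; under eq_integral do rewrite big_mkord.
elim: J J' B => [|s J IH] J' B.
  move=> uJ mB; rewrite big_nil mul1r -prod_indicators//.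
  by apply: eq_integral => w _; rewrite big_nil mul1r.
rewrite cat_cons /= => /andP[snJ uJ] mB.
pose H w := (\prod_(s <- J) g s (Y s w)) * (\prod_(s <- J') \1_(B s) (Y s w)).
have mH : measurable_fun setT H.
  apply: measurable_funM; apply: measurable_prod => s' _.
    exact: (measurableT_comp (mg s')).
  by apply: measurableT_comp => //; exact: measurable_indic.
have H0 w : 0 <= H w by rewrite mulr_ge0// prodr_ge0.
pose c := (\prod_(s <- J) e s) * (\prod_(s <- J') fine (F (B s))).
have c0 : 0 <= c by rewrite mulr_ge0// prodr_ge0// => s' _; rewrite fine_ge0.
transitivity (\int[pushforward (mdensity P mH H0) (Y s)]_x (g s x)%:E)%E.
  rewrite ge0_integral_pushforward//; last 2 first.
  - exact/measurable_EFinP.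
  - by move=> x _; rewrite lee_fin.
  rewrite [RHS](ge0_integral_mdensity P mH H0 (f := g s \o Y s)); last 2 first.
  - exact: (measurableT_comp (mg s)).
  - by move=> w; exact: g0.
  by apply: eq_integral => w _; rewrite big_cons -mulrA.
rewrite (eq_measure_integral (mscale (NngNum c0) F)); last first.
  move=> A mA _; rewrite /pushforward /= /mdensity /mscale /=.
  pose B' s' := if s' == s then A else B s'.
  have mB' s' : measurable (B' s') by rewrite /B'; case: ifP.
  have uJs : uniq (J ++ s :: J').
    by rewrite -(cat1s s) uniq_catCA /= snJ uJ.
  have key := IH (s :: J') B' uJs mB'.
  have snJ' : forall s', s' \in J' -> B' s' = B s'.
    move=> s' s'J'; rewrite /B' ifF//; apply: contraNF snJ => /eqP <-.
    by rewrite mem_cat s'J' orbT.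
  have prodE : \prod_(s' <- s :: J') fine (F (B' s')) =
      fine (F A) * \prod_(s' <- J') fine (F (B s')).
    rewrite big_cons {1}/B' eqxx; congr (_ * _).
    by rewrite big_seq [RHS]big_seq; apply: eq_bigr => s' /snJ' ->.
  have -> : (c%:E * F A)%E =
      ((\prod_(s <- J) e s) * \prod_(s' <- s :: J') fine (F (B' s')))%:E.
    by rewrite prodE mulrCA [RHS]EFinM fineK ?fin_num_measure// muleC.
  rewrite -key /pushforward [LHS]integral_mkcond; apply: eq_integral => w _.
  have -> : \prod_(s' <- s :: J') \1_(B' s') (Y s' w) =
      \1_A (Y s w) * \prod_(s' <- J') (\1_(B s') (Y s' w) : R).
    rewrite big_cons {1}/B' eqxx; congr (_ * _).
    by rewrite big_seq [RHS]big_seq; apply: eq_bigr => s' /snJ' ->.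
  rewrite mulrCA -/(H w) patchE indicE /=.
  have -> : (w \in Y s @^-1` A) = (Y s w \in A).
    by apply/idP/idP; rewrite !inE.
  by case: ifP => _; rewrite ?mul1r ?mul0r.
rewrite ge0_integral_mscale//; last 2 first.
- exact/measurable_EFinP.
- by move=> x _; rewrite lee_fin.
by rewrite ge big_cons /= -EFinM mulrC -mulrA.
Qed.

(** Markov's inequality for a product of independent factors that is at least 1
    on A. *)
Lemma chernoff_prod_iid (A : set T) (g : R -> R) (a : R) (t : nat) :
  measurable A -> measurable_fun setT g -> (forall x, 0 <= g x) ->
  (\int[F]_x (g x)%:E <= a%:E)%E ->
  (forall w, A w -> 1 <= \prod_(s < t) g (Y s w)) ->
  (P A <= (a ^+ t)%:E)%E.
Proof.
move=> mA mg g0 ga Ag.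
have gfin : (\int[F]_x (g x)%:E)%E \is a fin_num.
  by rewrite ge0_fin_numE ?(le_lt_trans ga) ?ltry// integral_ge0// => x _; rewrite lee_fin.
have e0 : 0 <= fine (\int[F]_x (g x)%:E)%E.
  by rewrite fine_ge0// integral_ge0// => x _; rewrite lee_fin.
have := @integral_prod_iid (fun=> g) (fun=> fine (\int[F]_x (g x)%:E)%E) t
  (fun=> mg) (fun=> g0) (fun=> esym (fineK gfin)).
rewrite prodr_const card_ord => Eprod.
apply: (@le_trans _ _ (\int[P]_w (\prod_(s < t) g (Y s w))%:E)%E).
  rewrite -(setIT A) -integral_indic//; apply: ge0_le_integral => //.
  - by apply/measurable_EFinP; exact: measurable_indic.
  - apply/measurable_EFinP; apply: measurable_prod => s _.
    exact: measurableT_comp.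
  - move=> w _; rewrite lee_fin indicE; case: (boolP (w \in A)) => wA.
      by apply: Ag; exact: set_mem.
    by rewrite prodr_ge0.
rewrite Eprod lee_fin lerXn2r ?nnegrE//.
  by rewrite (le_trans e0)// -lee_fin fineK.
by rewrite -lee_fin fineK.
Qed.

End independence.

(** * Bounding the divergence through a lower bound on the measure *)

Section kl_upper.
Context (R : realType).
Local Open Scope ereal_scope.
Local Open Scope charge_scope.

Lemma measurable_lne_fin d (T : measurableType d) (f : T -> \bar R) :
  measurable_fun setT f -> (forall x, f x \is a fin_num) ->
  measurable_fun setT (fun x => lne (f x)).
Proof.
move=> mf ffin.
have mff : measurable_fun setT (fun x => fine (f x)).
  by apply: measurableT_comp => //; exact: fine_measurable.
have -> : (fun x => lne (f x)) =
    (fun x => if (0 < fine (f x))%R then (ln (fine (f x)))%:E else -oo).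
  apply/funext => x; case: ifPn => f0.
    by rewrite -lne_EFin// fineK.
  by rewrite le0_lneNy// -[f x]fineK// lee_fin leNgt.
apply: measurable_fun_ifT => //; last first.
  by apply/measurable_EFinP; apply: measurableT_comp => //; exact: measurable_ln.
exact: measurable_fun_ltr.
Qed.

(** Both integrals may be infinite or of the form oo - oo: the inequality holds
    for the positive and the negative parts separately. *)
Lemma le_integral_measurable d (T : measurableType d)
    (m : {measure set T -> \bar R}) (f g : T -> \bar R) :
  measurable_fun setT f -> measurable_fun setT g -> (forall x, f x <= g x) ->
  \int[m]_x f x <= \int[m]_x g x.
Proof.
move=> mf mg fg; rewrite integralE [leRHS]integralE; apply: leeB.
  apply: ge0_le_integral => //; try exact: measurable_funepos.
  by move=> x _; apply: (@funepos_le _ _ setT f g); rewrite ?in_setT// => y _; exact: fg.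
apply: ge0_le_integral => //; try exact: measurable_funeneg.
by move=> x _; apply: (@funeneg_le _ _ setT f g); rewrite ?in_setT// => y _; exact: fg.
Qed.

Lemma measure_eq0_integral_gt0 d (T : measurableType d)
    (m : {measure set T -> \bar R}) (A : set T) (g : T -> R) :
  measurable A -> measurable_fun setT g -> (forall x, A x -> 0 < g x)%R ->
  \int[m]_(x in A) (g x)%:E <= 0 -> m A = 0.
Proof.
move=> mA mg g0 intg.
have mg' : measurable_fun A (EFin \o g).
  by apply/measurable_EFinP; exact: measurable_funTS.
have [+ _] := ae_eq_integral_abs m mA mg'.
under eq_integral => x xA.
  rewrite gee0_abs; last by rewrite lee_fin ltW// g0//; exact: set_mem.
  over.
case.
  apply/eqP; rewrite eq_le intg integral_ge0// => x Ax.
  by rewrite lee_fin ltW// g0.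
move=> N [mN N0 AN]; apply: subset_measure0 N0 => // x Ax; apply: AN => /= gx.
by have [gx0] := gx Ax; move: (g0 _ Ax); rewrite gx0 ltxx.
Qed.

(** If G dominates the measure with density 1 / psi with respect to F, then the
    density dF / dG is at most psi: on the set N where it exceeds psi, the
    change of variables would give N more G-mass than it has. *)
Lemma kl_le (F : {finite_measure set R -> \bar R}) (G : probability R R)
    (psi : R -> R) :
  measurable_fun setT psi -> (forall x, 0 < psi x)%R ->
  (forall A, measurable A -> \int[F]_(x in A) ((psi x)^-1)%:E <= G A) ->
  kl F G <= \int[F]_x (ln (psi x))%:E.
Proof.
move=> mpsi psi0 FG.
have mlnpsi : measurable_fun setT (fun x => ln (psi x)).
  by apply: measurableT_comp => //; exact: measurable_ln.
have mVpsi : measurable_fun setT (fun x => (psi x)^-1%R).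
  have -> : (fun x => (psi x)^-1%R) = (fun x => expR (- ln (psi x))).
    by apply/funext => x; rewrite expRN lnK// posrE.
  by apply: measurableT_comp => //; exact: measurableT_comp.
have Vpsi0 x : (0 < (psi x)^-1)%R by rewrite invr_gt0.
have FggG : F `<< G.
  apply/null_content_dominatesP => A mA GA.
  by apply: (measure_eq0_integral_gt0 mA mVpsi) => //; rewrite -GA FG.
rewrite /kl; case: asboolP => // _.
set f := 'd _ '/d _.
have ffin x : f x \is a fin_num by exact: Radon_Nikodym_fin_num.
have mf : measurable_fun setT f.
  by apply: measurable_int; exact: Radon_Nikodym_integrable.
have mff : measurable_fun setT (fun x => fine (f x)).
  by apply: measurableT_comp => //; exact: fine_measurable.
pose N := [set x | (psi x < fine (f x))%R].
have mN : measurable N.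
  have := measurable_fun_ltr mpsi mff => /(_ measurableT [set true]).
  rewrite setTI.
  by have -> : (fun x => psi x < fine (f x))%R @^-1` [set true] = N by [];
    exact.
have GN : G N = 0.
  have mg : measurable_fun setT (fun x => (psi x)^-1 * fine (f x) - 1)%R.
    by apply: measurable_funB => //; exact: measurable_funM.
  have g0 x : N x -> (0 < (psi x)^-1 * fine (f x) - 1)%R.
    by move=> Nx; rewrite subr_gt0 mulrC ltr_pdivlMr// mul1r.
  apply: (measure_eq0_integral_gt0 mN mg g0).
  have : \int[G]_(x in N) (((psi x)^-1 * fine (f x) - 1)%:E + (cst 1 x)) <= G N.
    rewrite (le_trans _ (FG N mN))// -(Radon_Nikodym_change_of_variables FggG mN).
      rewrite le_eqVlt; apply/orP; left; apply/eqP; apply: eq_integral => x _.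
      by rewrite /= EFinB subeK// EFinM fineK.
    apply/integrableP; split.
      by apply/measurable_EFinP; exact: measurable_funTS.
    under eq_integral do rewrite gee0_abs ?lee_fin ?ltW//.
    by rewrite (le_lt_trans (FG N mN))// ltey_eq fin_num_measure.
  rewrite ge0_integralD//; last 2 first.
  - by move=> x /g0; rewrite lee_fin => /ltW.
  - by apply/measurable_EFinP; exact: measurable_funTS.
  rewrite integral_cst// mul1e => le0.
  by rewrite -(leeD2rE _ _ (fin_num_measure G _ mN)) add0e.
have FN : F N = 0 by move/null_content_dominatesP: FggG; apply.
have -> : \int[F]_x lne (f x) = \int[F]_x lne (mine (f x) (psi x)%:E).
  apply: ae_eq_integral => //.
  - exact: measurable_lne_fin.
  - apply: measurable_lne_fin.
      by apply: measurable_mine => //; exact/measurable_EFinP.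
    by move=> x; rewrite /Order.min; case: ifPn.
  exists N; split => // x /=; rewrite not_implyE => -[_].
  apply: contra_notP => /negP; rewrite /N /= -leNgt -lee_fin fineK// => le.
  by rewrite min_l.
apply: le_integral_measurable.
- apply: measurable_lne_fin.
    by apply: measurable_mine => //; exact/measurable_EFinP.
  by move=> x; rewrite /Order.min; case: ifPn.
- exact/measurable_EFinP.
- move=> x; rewrite -lne_EFin//.
  have [m0|m0] := leP (mine (f x) (psi x)%:E) 0; first by rewrite le0_lneNy ?leNye.
  rewrite lee_lne ?ge_min ?lexx ?orbT// in_itv/= leey andbT; first exact: ltW.
  by rewrite lee_fin ltW.
Qed.
End kl_upper.

(** * Wealth functions and tilted distributions *)

(** Factor by which the capital of a gambler is multiplied by the outcome x in a game
    with stake nu that is fair for outcomes of mean mu and favourable for smaller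
    means.  The outcome is clipped at 1 so that the factor is positive everywhere,
    and not only almost everywhere for distributions on (-oo, 1]. *)
Definition wealth (R : realType) (mu nu x : R) : R :=
  1 - nu * (Num.min x 1 - mu).

Section wealth.
Context (R : realType).
Implicit Types (mu nu x : R).

Lemma wealth_ge mu nu x : 0 <= nu -> 1 - nu * (1 - mu) <= wealth mu nu x.
Proof.
move=> nu0; rewrite /wealth lerD2l lerN2 ler_wpM2l// lerD2r.
by rewrite ge_min lexx orbT.
Qed.

Lemma wealth_gt0 mu nu x : 0 <= nu -> nu * (1 - mu) < 1 -> 0 < wealth mu nu x.
Proof. by move=> nu0 nu1; rewrite (lt_le_trans _ (wealth_ge _ _ nu0))// subr_gt0. Qed.

Lemma measurable_wealth mu nu : measurable_fun setT (wealth mu nu).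
Proof.
apply: measurable_funB => //; apply: measurable_funM => //.
by apply: measurable_funB => //; exact: measurable_minr.
Qed.

Lemma measurable_inv_wealth mu nu : 0 <= nu -> nu * (1 - mu) < 1 ->
  measurable_fun setT (fun x => (wealth mu nu x)^-1).
Proof.
move=> nu0 nu1.
have -> : (fun x => (wealth mu nu x)^-1) = (fun x => expR (- ln (wealth mu nu x))).
  by apply/funext => x; rewrite expRN lnK// posrE wealth_gt0.
apply: measurableT_comp => //; apply: measurableT_comp => //.
by apply: measurableT_comp; [exact: measurable_ln|exact: measurable_wealth].
Qed.

End wealth.

Section unit_mass_semibounded.
Context (R : realType) (F : {finite_measure set R -> \bar R}).
Hypotheses (F1 : F setT = 1%E) (Fle1 : F `]-oo, 1]%classic = 1%E).

Lemma ae_min1 : {ae F, forall x, Num.min x 1 = x}.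
Proof.
exists (~` `]-oo, 1]%classic); split.
- exact: measurableC.
- rewrite -setTD measureD//; last by rewrite ltey_eq fin_num_measure.
  rewrite setTI; have : (F setT - F (`]-oo, 1%R]%classic : set R) = 0)%E.
    by rewrite F1 Fle1 subee.
  by [].
- by move=> x /= h; rewrite in_itv/= => x1; apply: h; rewrite minEle x1.
Qed.

Lemma integral_min1 :
  (\int[F]_x (Num.min x 1)%:E = \int[F]_x x%:E)%E.
Proof.
apply: ae_eq_integral => //.
- by apply/measurable_EFinP; exact: measurable_minr.
- by case: ae_min1 => N [mN N0 sN]; exists N; split => // x /= h; apply: sN => /= e; apply: h; rewrite e.
Qed.

Hypothesis iF : F.-integrable setT EFin.

Lemma integrable_min1 : F.-integrable setT (fun x => (Num.min x 1)%:E).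
Proof.
apply: (@le_integrable _ _ _ F _ measurableT (fun x => (Num.min x 1)%:E)
  (fun x => (`|x| + 1)%:E)).
- by apply/measurable_EFinP; exact: measurable_minr.
- move=> x _ /=; rewrite lee_fin [leRHS]ger0_norm// ler_norml.
  rewrite le_min ge_min.
  have := ler_norm x; have := ler_norm (- x); rewrite normrN.
  by move=> h1 h2; apply/andP; split; [apply/andP; split|apply/orP; left]; lra.
- rewrite (_ : (fun _ => _) = (fun x => `|x%:E| + (cst 1 x)%:E)%E); last exact/funext.
  apply: integrableD => //; last exact: finite_measure_integrable_cst.
  exact: integrable_abse.
Qed.

Section growth.
Variables (mu nu : R).
Hypotheses (nu0 : 0 <= nu) (nu1 : nu * (1 - mu) < 1).
Local Notation w := (wealth mu nu).

Lemma integrable_wealth : F.-integrable setT (fun x => (w x)%:E).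
Proof.
rewrite (_ : (fun _ => _) =
  (fun x => (cst (1 + nu * mu) x)%:E - nu%:E * (Num.min x 1)%:E)%E); last first.
  by apply/funext => x; rewrite -EFinM -EFinB /w /wealth /=; congr EFin; ring.
apply: integrableB => //; first exact: finite_measure_integrable_cst.
by apply: integrableZl => //; exact: integrable_min1.
Qed.

Lemma Rintegral_cst1 (k : R) : \int[F]_x k = k.
Proof. by rewrite /Rintegral (integral_cst1 F1). Qed.

Lemma Rintegral_wealth : \int[F]_x w x = 1 - nu * (\int[F]_x x - mu).
Proof.
rewrite (@eq_Rintegral _ _ _ F setT (fun x => (1 + nu * mu) - nu * Num.min x 1)); last first.
  by move=> x _; rewrite /wealth; ring.
rewrite RintegralB//; [|exact: finite_measure_integrable_cst|]; last first.
  by apply: (integrableZl _ nu integrable_min1).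
rewrite Rintegral_cst1 RintegralZl//; last exact: integrable_min1.
by rewrite {1}/Rintegral integral_min1 -/(Rintegral F setT id); ring.
Qed.

Lemma integrable_inv_wealth : F.-integrable setT (fun x => (w x)^-1%:E).
Proof.
apply: (@le_integrable _ _ _ F _ measurableT (fun x => (w x)^-1%:E)
  (cst ((1 - nu * (1 - mu))^-1)%:E)).
- by apply/measurable_EFinP; exact: measurable_inv_wealth.
- move=> x _ /=; rewrite lee_fin gtr0_norm ?invr_gt0 ?wealth_gt0//.
  rewrite gtr0_norm ?invr_gt0 ?subr_gt0//.
  by rewrite lef_pV2 ?posrE; [exact: wealth_ge|exact: wealth_gt0|rewrite subr_gt0].
- exact: finite_measure_integrable_cst.
Qed.

Lemma integrable_ln_wealth : F.-integrable setT (fun x => (ln (w x))%:E).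
Proof.
apply: (@le_integrable _ _ _ F _ measurableT (fun x => (ln (w x))%:E)
  (fun x => (w x)%:E + (w x)^-1%:E)%E).
- apply/measurable_EFinP; apply: measurableT_comp; first exact: measurable_ln.
  exact: measurable_wealth.
- move=> x _ /=; have w0 := wealth_gt0 x nu0 nu1.
  have wV0 : 0 < (w x)^-1 by rewrite invr_gt0.
  rewrite lee_fin [leRHS]ger0_norm; last by rewrite addr_ge0// ltW.
  have h1 := ln_sublinear w0; have h2 := ln_sublinear wV0.
  by rewrite lnV ?posrE// in h2; rewrite ler_norml; apply/andP; split; lra.
- by apply: integrableD => //; [exact: integrable_wealth|exact: integrable_inv_wealth].
Qed.

End growth.


End unit_mass_semibounded.

Lemma emean_semibounded (R : realType) (G : probability R R) (a : R) :
  semibounded G -> (\int[G]_x (1 - Num.min x 1)%:E = a%:E)%E ->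
  emean G = (1 - a)%:E.
Proof.
move=> Gle1 Ga.
have iG : G.-integrable setT (fun x => (1 - Num.min x 1)%:E).
  apply/integrableP; split.
    by apply/measurable_EFinP/measurable_funB => //; exact: measurable_minr.
  under eq_integral.
    move=> x _; rewrite gee0_abs; last first.
      by rewrite lee_fin subr_ge0 ge_min lexx orbT.
    over.
  by rewrite Ga ltry.
rewrite /emean -(@integral_min1 _ G _ Gle1); last exact: probability_setT.
transitivity (\int[G]_x ((cst 1%E x) - (1 - Num.min x 1)%:E))%E.
  by apply: eq_integral => x _; rewrite -EFinB; congr EFin; ring.
rewrite integralB//; last exact: (finite_measure_integrable_cst G 1).
rewrite Ga integral_cst//; transitivity (1 * 1 - a%:E)%E; last by rewrite mule1.
by congr (_ * _ - _)%E; exact: (probability_setT G).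
Qed.

Lemma mnormalize_unit_mass d (T : measurableType d) (R : realType)
    (m : {measure set T -> \bar R}) (P : probability T R) (A : set T) :
  m setT = 1%E -> mnormalize m P A = m A.
Proof. by move=> m1; rewrite /mnormalize m1 onee_eq0 /= invr1 mule1. Qed.

Section tilting.
Context (R : realType) (F : {finite_measure set R -> \bar R}).
Hypotheses (F1 : F setT = 1%E) (Fle1 : F `]-oo, 1]%classic = 1%E).
Hypothesis iF : F.-integrable setT EFin.
Variables (mu nu c : R).
Hypotheses (nu0 : 0 < nu) (nu1 : nu * (1 - mu) < 1).
Local Notation w := (wealth mu nu).
Let g := \int[F]_x (w x)^-1.

(** The competitor G has density c / w with respect to F, and the mass 1 - c g that
    is missing is put at the largest possible reward 1.  The last hypothesis says
    that the mean of G exceeds mu, since 1 - x has G-integral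
    c ((1 - mu) g + (1 - g) / nu). *)
Lemma Dinf_le_tilting : 0 < c -> c * g <= 1 ->
  c * ((1 - mu) * g + (1 - g) / nu) < 1 - mu ->
  (Dinf F mu <= (\int[F]_x (ln (w x)) - ln c)%:E)%E.
Proof.
move=> c0 cg1 mean_gt.
have nu0' := ltW nu0.
have w0 x : 0 < w x by exact: wealth_gt0.
have Vw0 x : 0 <= (w x)^-1 by rewrite invr_ge0 ltW.
have mVw := measurable_inv_wealth nu0' nu1.
have iVw := integrable_inv_wealth F nu0' nu1.
have gE : (\int[F]_x (w x)^-1%:E = g%:E)%E.
  by rewrite /g /Rintegral fineK//; exact: integrable_fin_num iVw.
have b0 : 0 <= 1 - c * g by rewrite subr_ge0.
pose m := measure_add (mscale (NngNum (ltW c0)) (mdensity F mVw Vw0))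
  (mscale (NngNum b0) (\d_(1 : R))).
have mE A : m A = (c%:E * (\int[F]_(x in A) (w x)^-1%:E) +
    (1 - c * g)%:E * \d_(1%R : R) A)%E.
  by rewrite /m measure_addE.
have m1 : m setT = 1%E.
  by rewrite mE gE diracT mule1 -EFinM -EFinD; congr EFin; ring.
pose m' : {measure set R -> \bar R} := m.
pose G : probability R R := mnormalize m' (\d_(1 : R)).
have GE A : G A = m A.
  by have := @mnormalize_unit_mass _ _ _ m' (\d_(1 : R)) A m1.
have Gle1 : semibounded G.
  rewrite /semibounded GE mE diracE mem_set ?mule1/=; last by rewrite in_itv/= lexx.
  suff -> : (\int[F]_(x in `]-oo, 1%R]%classic) (w x)^-1%:E = g%:E)%E.
    by rewrite -EFinM -EFinD; congr EFin; ring.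
  rewrite -gE [RHS](@ge0_negligible_integral _ R R F setT (~` (`]-oo, 1%R]%classic : set R))) => //.
  - by rewrite setDE setCK setTI.
  - exact: measurableC.
  - exact/measurable_EFinP.
  - by move=> x _; rewrite lee_fin.
  - rewrite -setTD measureD//; last by rewrite ltey_eq fin_num_measure.
    rewrite setTI; have : (F setT - F (`]-oo, 1%R]%classic : set R) = 0)%E.
      by rewrite F1 Fle1 subee.
    by [].
have meanG : (emean G =
    (1 - c * ((1 - mu) * g + (1 - g) / nu))%:E)%E.
  apply: emean_semibounded => //.
  have m1min : measurable_fun setT (fun x : R => 1 - Num.min x 1).
    by apply: measurable_funB => //; exact: measurable_minr.
  have min0 (x : R) : 0 <= 1 - Num.min x 1 by rewrite subr_ge0 ge_min lexx orbT.
  rewrite (eq_measure_integral m); last by move=> A _ _; exact: GE.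
  rewrite ge0_integral_measure_add//; last 2 first.
  - by move=> x _; rewrite lee_fin.
  - exact/measurable_EFinP.
  rewrite !ge0_integral_mscale//; try exact/measurable_EFinP; try by move=> x _; rewrite lee_fin.
  rewrite (ge0_integral_mdensity F mVw Vw0)// integral_dirac//; last exact/measurable_EFinP.
  rewrite minxx subrr !mule0 adde0 /=.
  rewrite EFinM; congr (_ * _)%E.
  transitivity (\int[F]_x (((1 - mu) - nu^-1)%:E * (w x)^-1%:E + (cst nu^-1 x)%:E))%E.
    apply: eq_integral => x _; rewrite -EFinM -EFinD; congr EFin.
    have := w0 x; rewrite /wealth /cst => w0x; field.
    by rewrite !gt_eqF.
  rewrite integralD//; last 2 first.
  - exact: integrableZl.
  - exact: finite_measure_integrable_cst.
  rewrite integralZl// gE (integral_cst1 F1 nu^-1).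
  by rewrite -EFinM -EFinD; congr EFin; ring.
apply: (@le_trans _ _ (kl F G)).
  apply: ereal_inf_lbound; exists G => //; split => //.
  by rewrite meanG lte_fin; lra.
have iln := integrable_ln_wealth iF nu0' nu1.
apply: (@le_trans _ _ (\int[F]_x (ln (w x / c))%:E)%E).
  apply: kl_le.
  - by apply: measurable_funM => //; exact: measurable_wealth.
  - by move=> x; rewrite divr_gt0.
  - move=> A mA; rewrite GE mE -[leLHS]adde0; apply: leeD; last first.
      by rewrite mule_ge0 ?lee_fin.
    rewrite le_eqVlt; apply/orP; left; apply/eqP.
    rewrite -ge0_integralZl//.
    + by apply: eq_integral => x _; rewrite invfM invrK mulrC EFinM.
    + by apply/measurable_EFinP; exact: measurable_funTS.
    + by move=> x _; rewrite lee_fin.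
    + by rewrite lee_fin ltW.
rewrite EFinB /Rintegral fineK; last exact: integrable_fin_num iln.
have -> : (\int[F]_x (ln (w x / c))%:E =
    \int[F]_x ((ln (w x))%:E - (cst (ln c) x)%:E))%E.
  by apply: eq_integral => x _; rewrite -EFinB ln_div ?posrE.
rewrite integralB//; last exact: finite_measure_integrable_cst.
rewrite leeB//.
by rewrite (integral_cst1 F1 (ln c)).
Qed.
End tilting.

(** * Duality for Dinf *)

Section duality.
Context (R : realType) (F : {finite_measure set R -> \bar R}).
Hypotheses (F1 : F setT = 1%E) (Fle1 : F `]-oo, 1]%classic = 1%E).
Hypothesis iF : F.-integrable setT EFin.
Variable mu : R.
Local Notation g nu := (\int[F]_x (wealth mu nu x)^-1).

(** Controls how much g can increase between two neighbours of a fine grid. *)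
Let lipschitz_inv_wealth (nub nu1 nu2 : R) : 0 <= nu1 -> nu1 <= nu2 ->
  nu2 <= nub -> nub * (1 - mu) < 1 -> mu < 1 ->
  g nu2 <= g nu1 + (nu2 - nu1) *
    (\int[F]_x `|Num.min x 1 - mu| / (1 - nub * (1 - mu)) ^+ 2).
Proof.
move=> nu10 nu12 nu2b nub1 mu1.
have nu20 : 0 <= nu2 by lra.
have h1 : nu1 * (1 - mu) < 1 by nra.
have h2 : nu2 * (1 - mu) < 1 by nra.
have i1 := integrable_inv_wealth F nu10 h1.
have i2 := integrable_inv_wealth F nu20 h2.
have imin : F.-integrable setT (fun x => (`|Num.min x 1 - mu|)%:E).
  apply: (@integrable_abse _ _ _ F setT
    (fun x => ((Num.min x 1)%:E - (cst mu x)%:E)%E) _).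
  by apply: integrableB; [| exact: integrable_min1 |
    exact: finite_measure_integrable_cst].
set b := 1 - nub * (1 - mu).
have b0 : 0 < b by rewrite subr_gt0.
have -> : (nu2 - nu1) * (\int[F]_x `|Num.min x 1 - mu| / b ^+ 2) =
    \int[F]_x ((nu2 - nu1) / b ^+ 2 * `|Num.min x 1 - mu|).
  by rewrite RintegralZl//; ring.
rewrite -RintegralD//; last exact: (integrableZl measurableT _ imin).
apply: le_Rintegral => //.
  exact: (integrableD measurableT i1 (integrableZl measurableT _ imin)).
move=> x _.
have w1 : b <= wealth mu nu1 x.
  by apply: le_trans (wealth_ge _ _ _) => //; rewrite /b; nra.
have w2 : b <= wealth mu nu2 x.
  by apply: le_trans (wealth_ge _ _ _) => //; rewrite /b; nra.
have w10 := lt_le_trans b0 w1; have w20 := lt_le_trans b0 w2.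
have -> : (wealth mu nu2 x)^-1 = (wealth mu nu1 x)^-1 +
    (nu2 - nu1) * ((Num.min x 1 - mu) / (wealth mu nu1 x * wealth mu nu2 x)).
  by move: w10 w20; rewrite /wealth => w10 w20; field; rewrite !gt_eqF.
rewrite lerD2l -mulrA ler_wpM2l ?subr_ge0//.
rewrite (le_trans (ler_norm _))// normrM mulrC.
rewrite ler_wpM2r// gtr0_norm ?invr_gt0 ?mulr_gt0//.
rewrite lef_pV2 ?posrE ?mulr_gt0 ?exprn_gt0// expr2.
by rewrite ler_pM// ltW.
Qed.

Let crossing (p : pred nat) (n : nat) : p 0%N -> ~~ p n ->
  exists2 j : nat, (j < n)%N & p j && ~~ p j.+1.
Proof.
move=> p0; elim: n => [|n IH] pn; first by rewrite p0 in pn.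
have [pn'|/IH[j jn pj]] := boolP (p n); first by exists n; rewrite // pn' pn.
by exists j => //; exact: ltnW.
Qed.

(** The hard half, up to eta, of the identity between Dinf F mu and the maximum over nu
    of the logarithmic growth F (ln (wealth mu nu)).  The growth is concave in nu and
    its derivative has the sign of 1 - g nu, where g nu = F (1 / wealth mu nu).
    Instead of a maximizer, the proof takes a point of a fine grid of [0, nub] where g
    passes above 1, or nub itself if g is at most 1 there; nub is close to the end
    point 1 / (1 - mu).
    Normalizing by c = 1 / g in the first case and by c = exp (- eta) in the second
    costs at most eta in the divergence.  The bound on g nu, which expresses that nu
    is nearly optimal, is what controls the small values of the wealth in the
    deviation bound below. *)
Lemma Dinf_duality (eta : R) : mu < 1 -> 0 < eta ->
  exists nu : R, [/\ 0 <= nu, nu * (1 - mu) < 1, g nu <= 1 + eta &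
    (Dinf F mu <= (\int[F]_x (ln (wealth mu nu x)) + eta)%:E)%E].
Proof.
move=> mu1 eta0.
pose c := expR (- eta).
have c0 : 0 < c by exact: expR_gt0.
have c1 : c < 1 by rewrite expR_lt1 oppr_lt0.
(* Any theta strictly between c and 1 works. *)
pose theta := (1 + c) / 2.
have cth : c < theta by rewrite /theta; lra.
have th1 : theta < 1 by rewrite /theta; lra.
have th0 : 0 < theta by lra.
pose nub := theta / (1 - mu).
have mu0 : 0 < 1 - mu by lra.
have nubE : nub * (1 - mu) = theta by rewrite /nub divfK// gt_eqF.
have nub0 : 0 < nub by rewrite divr_gt0.
pose L := \int[F]_x `|Num.min x 1 - mu| / (1 - nub * (1 - mu)) ^+ 2.
have L0 : 0 <= L.
  rewrite mulr_ge0 ?invr_ge0 ?exprn_even_ge0//.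
  exact: Rintegral_ge0.
pose M := (Num.bound (nub * L / eta)).+1.
have LM : nub * L / M%:R <= eta.
  have x0 : 0 <= nub * L / eta.
    by apply: divr_ge0; [apply: mulr_ge0 => //|]; exact: ltW.
  rewrite ler_pdivrMr ?ltr0n// [leRHS]mulrC -ler_pdivrMr//.
  by rewrite ltW// (lt_le_trans (archi_boundP x0))// ler_nat.
pose nu j := nub * (j%:R / M%:R).
have nuM j : (j <= M)%N -> 0 <= nu j <= nub.
  move=> jM; rewrite /nu; apply/andP; split.
    by apply: mulr_ge0; [exact: ltW|exact: divr_ge0].
  by rewrite ger_pMr// ler_pdivrMr ?ltr0n// mul1r ler_nat.
have [gM|gM] := leP (g (nu M)) 1.
  have nuME : nu M = nub by rewrite /nu divff ?mulr1 ?pnatr_eq0.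
  rewrite nuME in gM.
  exists nub; split; [exact: ltW | by rewrite nubE | |].
    by rewrite (le_trans gM)// lerDl ltW.
  have g0 : 0 <= g nub.
    apply: Rintegral_ge0 => x _; rewrite invr_ge0 ltW// wealth_gt0 ?ltW//.
    by rewrite nubE.
  have nub1 : nub * (1 - mu) < 1 by rewrite nubE.
  apply: le_trans (Dinf_le_tilting F1 Fle1 iF nub0 nub1 c0 _ _) _; last first.
  - by rewrite /c expRK opprK.
  - set G := g nub in g0 gM *.
    have -> : c * ((1 - mu) * G + (1 - G) / nub) =
        (1 - mu) * ((c / theta) * (theta * G + (1 - G))).
      by rewrite -nubE; field; rewrite !gt_eqF.
    rewrite gtr_pMr//.
    have ct1 : c / theta < 1 by rewrite ltr_pdivrMr// mul1r.
    have ct0 : 0 < c / theta by rewrite divr_gt0.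
    set q := c / theta in ct0 ct1 *.
    have s1 : theta * G + (1 - G) <= 1 by nra.
    have s0 : 0 <= theta * G + (1 - G) by nra.
    by set s := theta * G + _ in s0 s1 *; nra.
  - by nra.
have [j jM /andP[gj gj1]] : exists2 j, (j < M)%N &
    (g (nu j) <= 1) && ~~ (g (nu j.+1) <= 1).
  apply: (crossing (p := fun j => g (nu j) <= 1)); last by rewrite -ltNge.
  rewrite /nu mul0r mulr0 (eq_Rintegral _ _ (g := fun=> 1)); last first.
    by move=> x _; rewrite /wealth mul0r subr0 invr1.
  by rewrite Rintegral_cst1.
rewrite -ltNge in gj1.
have /andP[nuj0 _] := nuM j (ltnW jM).
have /andP[_ nuj1b] := nuM _ jM.
have nuj1 : 0 < nu j.+1 by rewrite mulr_gt0// divr_gt0 ?ltr0n.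
have nuj1lt : nu j.+1 * (1 - mu) < 1.
  by rewrite (le_lt_trans _ th1)// -nubE ler_wpM2r// ltW.
have gub : g (nu j.+1) <= 1 + eta.
  have := lipschitz_inv_wealth nuj0 _ nuj1b.
  rewrite nubE => /(_ _ th1 mu1); rewrite -nubE -/L => lip.
  apply: le_trans (lip _) _.
    by rewrite /nu ler_pM2l// ler_pM2r ?invr_gt0 ?ltr0n// ler_nat.
  apply: lerD => //.
  have -> : (nu j.+1 - nu j) * L = nub * L / M%:R.
    by rewrite /nu -natr1; ring.
  exact: LM.
exists (nu j.+1); split => //; first exact: ltW.
have g0 : 0 < g (nu j.+1) by lra.
have lng : ln (g (nu j.+1)) <= eta.
  have := @le_ln1Dx _ (g (nu j.+1) - 1).
  by rewrite [1 + _]addrC subrK => h; rewrite (le_trans (h _))//; lra.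
apply: le_trans (Dinf_le_tilting F1 Fle1 iF nuj1 nuj1lt (c := (g (nu j.+1))^-1) _ _ _) _.
- by rewrite invr_gt0.
- by rewrite mulVf// gt_eqF.
- have -> : (g (nu j.+1))^-1 *
      ((1 - mu) * g (nu j.+1) + (1 - g (nu j.+1)) / nu j.+1) =
      (1 - mu) + (1 - g (nu j.+1)) / (g (nu j.+1) * nu j.+1).
    by field; rewrite !gt_eqF.
  rewrite gtrDl pmulr_llt0 ?subr_lt0// invr_gt0 mulr_gt0//.
- by rewrite lnV ?posrE// opprK lee_fin lerD2l.
Qed.

End duality.

(** * Empirical distributions *)

(** The positive part is bounded by 1, so a mean larger than a real number excludes
    an infinite negative part. *)
Lemma integrable_semibounded (R : realType) (G : probability R R) (m : R) :
  semibounded G -> (m%:E < emean G)%E -> G.-integrable setT EFin.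
Proof.
move=> Gle1 mG.
have mid : measurable_fun setT (EFin : R -> \bar R) by [].
have posfin : (\int[G]_x (EFin^\+ x) < +oo)%E.
  apply: (@le_lt_trans _ _ (\int[G]_x cst 1 x)%E); last first.
    rewrite integral_cst// mul1e.
    by rewrite -[ltLHS]/(G setT) probability_setT ltry.
  apply: ae_ge0_le_integral => //.
    exact: measurable_funepos.
  have [N [mN N0 sN]] := @ae_min1 _ G (probability_setT G) Gle1.
  exists N; split => // x /= nle; apply: sN => /= xmin; apply: nle => _.
  by rewrite funeposE ge_max lee_fin -{1}xmin ge_min lexx orbT lee_fin ler01.
have negfin : (\int[G]_x (EFin^\- x) < +oo)%E.
  rewrite ltey; apply/eqP => negy; move: mG.
  rewrite /emean integralE negy /= addeC => /=.
  have : (\int[G]_x (EFin^\+ x) \is a fin_num)%E.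
    by rewrite ge0_fin_numE// integral_ge0.
  by case: (\int[G]_x _)%E.
rewrite [X in integrable _ _ X]funeposneg.
apply: integrableB => //; apply/integrableP; split.
- exact: measurable_funepos.
- by under eq_integral do rewrite gee0_abs//.
- exact: measurable_funeneg.
- by under eq_integral do rewrite gee0_abs//.
Qed.

Section empirical.
Context (R : realType) (x : nat -> R) (t : nat).
Local Notation Fhat := (empirical x t).

Lemma ge0_integral_empirical (h : R -> \bar R) :
  measurable_fun setT h -> (forall y, 0 <= h y)%E ->
  (\int[Fhat]_y h y = (t%:R^-1)%:E * \sum_(s < t) h (x s))%E.
Proof.
move=> mh h0.
rewrite (eq_measure_integral (mscale (t%:R^-1)%:nng (msum (fun s => \d_(x s)) t)))//.
rewrite ge0_integral_mscale// ge0_integral_measure_sum//; congr (_ * _)%E.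
by apply: eq_bigr => s _; rewrite integral_dirac// diracT mul1e.
Qed.

Lemma integral_empirical (h : R -> \bar R) :
  measurable_fun setT h -> (forall s : 'I_t, h (x s) \is a fin_num) ->
  (\int[Fhat]_y h y = (t%:R^-1 * \sum_(s < t) fine (h (x s)))%:E)%E.
Proof.
move=> mh hfin; rewrite integralE.
rewrite !ge0_integral_empirical//; last 2 first.
- exact: measurable_funeneg.
- exact: measurable_funepos.
have posE (s : 'I_t) : h^\+%E (x s) = (fine (h^\+%E (x s)))%:E.
  by rewrite fineK// funeposE; case: (h (x s)) (hfin s) => //= r _; rewrite maxEle; case: ifP.
have negE (s : 'I_t) : h^\-%E (x s) = (fine (h^\-%E (x s)))%:E.
  by rewrite fineK// funenegE; case: (h (x s)) (hfin s) => //= r _; rewrite maxEle; case: ifP.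
under eq_bigr do rewrite posE.
under [X in (_ - _ * X)%E]eq_bigr do rewrite negE.
rewrite !sumEFin -!EFinM -EFinB -mulrBr -sumrB; congr (_ * _)%:E.
apply: eq_bigr => s _; apply: EFin_inj; rewrite EFinB -posE -negE fineK//.
by have := congr1 (@^~ (x s)) (funeposneg h) => /= ->.
Qed.

Lemma integrable_empirical (h : R -> R) :
  measurable_fun setT h -> Fhat.-integrable setT (EFin \o h).
Proof.
move=> mh; apply/integrableP; split; first exact/measurable_EFinP.
rewrite integral_empirical ?ltry//.
by apply: measurableT_comp => //; exact/measurable_EFinP.
Qed.

Lemma Rintegral_empirical (h : R -> R) : measurable_fun setT h ->
  \int[Fhat]_y h y = t%:R^-1 * \sum_(s < t) h (x s).
Proof. by move=> mh; rewrite /Rintegral integral_empirical//; exact/measurable_EFinP. Qed.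

Lemma empiricalE (A : set R) : measurable A ->
  Fhat A = (t%:R^-1 * \sum_(s < t) \1_A (x s))%:E.
Proof.
move=> mA; rewrite -[LHS]/((t%:R^-1)%:E * (msum (fun s => \d_(x s)) t) A)%E.
by rewrite /msum EFinM -sumEFin.
Qed.

Hypothesis t0 : (0 < t)%N.

Lemma empirical_setT : Fhat setT = 1%E.
Proof.
rewrite empiricalE//; under eq_bigr do rewrite indicE in_setT.
by rewrite sumr_const card_ord mulVf// pnatr_eq0 -lt0n.
Qed.

Lemma empirical_le1 : (forall s : 'I_t, x s <= 1) ->
  Fhat (`]-oo, 1]%classic : set R) = 1%E.
Proof.
move=> x1; rewrite empiricalE//; under eq_bigr => s _.
  rewrite indicE mem_set; last by rewrite /= in_itv/= x1.
  over.
by rewrite sumr_const card_ord mulVf// pnatr_eq0 -lt0n.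
Qed.

(** Weak duality: for G with density f = dFhat / dG and mean larger than m,
    ln (w / f) <= w / (f c) - 1 + ln c at each observation, and the Fhat-average of
    w / f is at most the G-integral of w, which is at most c = 1 + nu (mu - m). *)
Lemma Dinf_empirical_ge (mu nu m : R) : 0 <= nu -> nu * (1 - mu) < 1 -> m <= mu ->
  ((t%:R^-1 * \sum_(s < t) ln (wealth mu nu (x s)) - ln (1 + nu * (mu - m)))%:E
     <= Dinf Fhat m)%E.
Proof.
move=> nu0 nu1 m_mu; apply: le_ereal_inf_tmp => _ [G [Gle1 mG] <-].
rewrite /kl; case: asboolP => [dom|_]; last by rewrite leey.
set f := Radon_Nikodym _ _.
have ffin y : f y \is a fin_num by exact: Radon_Nikodym_fin_num.
have mf : measurable_fun setT f.
  by apply: measurable_int; exact: Radon_Nikodym_integrable.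
have mff : measurable_fun setT (fun y => fine (f y)).
  by apply: measurableT_comp => //; exact: fine_measurable.
have iG := integrable_semibounded Gle1 mG.
have tV0 : 0 < t%:R^-1 :> R by rewrite invr_gt0 ltr0n.
have f0 (s : 'I_t) : 0 < fine (f (x s)).
  have : (0 < Fhat [set x s])%E.
    rewrite empiricalE// lte_fin mulr_gt0// (bigD1 s)//=.
    by rewrite indicE mem_set// ltr_pwDl// sumr_ge0.
  rewrite (_ : Fhat [set x s] = \int[G]_(y in [set x s]) f y)%E; last first.
    exact: (Radon_Nikodym_integral (nu := charge_of_finite_measure Fhat) dom).
  rewrite (eq_integral (cst (f (x s)))); last by move=> y /[!inE] ->.
  rewrite integral_cst// -[f (x s)]fineK//.
  case: (ltP 0 (fine (f (x s)))) => // f0; rewrite ltNge => /negP; case.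
  by rewrite mule_le0_ge0// lee_fin.
have w0 y : 0 < wealth mu nu y by exact: wealth_gt0.
have c0 : 0 < 1 + nu * (mu - m).
  by rewrite ltr_pwDl// mulr_ge0// subr_ge0.
(* The quotient of the wealth by f; since ln is 0 on nonpositive numbers, it is
   just the wealth where f <= 0, which keeps the next inequality true. *)
pose u y := wealth mu nu y * expR (- ln (fine (f y))).
have mw := measurable_wealth mu nu.
have mu_ : measurable_fun setT u.
  apply: measurable_funM => //; apply: measurableT_comp => //.
  apply: measurableT_comp => //; apply: measurableT_comp => //.
have uf y : u y * fine (f y) <= wealth mu nu y.
  have [fy|fy] := ltP 0 (fine (f y)).
    by rewrite /u expRN lnK ?posrE// divfK// gt_eqF.
  rewrite (le_trans _ (ltW (w0 y)))//; apply: mulr_ge0_le0 => //.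
  by apply: mulr_ge0; [exact/ltW/w0|exact: expR_ge0].
have wG : \int[G]_y wealth mu nu y <= 1 + nu * (mu - m).
  rewrite (Rintegral_wealth (probability_setT G) Gle1 iG).
  rewrite -[X in _ <= 1 + nu * X]opprB mulrN lerD2l lerN2 ler_wpM2l//.
  rewrite lerD2r -lee_fin fineK; first exact: ltW.
  exact: integrable_fin_num iG.
have sum_le : t%:R^-1 * (\sum_(s < t) wealth mu nu (x s) / fine (f (x s))) <=
    1 + nu * (mu - m).
  rewrite (le_trans _ wG)// -lee_fin.
  have iw := @integrable_wealth _ G iG mu nu.
  have iu := integrable_empirical mu_.
  have -> : (\int[G]_y wealth mu nu y)%:E = (\int[G]_y (wealth mu nu y)%:E)%E.
    by rewrite /Rintegral fineK//; exact: integrable_fin_num iw.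
  have -> : \sum_(s < t) wealth mu nu (x s) / fine (f (x s)) =
      \sum_(s < t) u (x s).
    by apply: eq_bigr => s _; rewrite /u expRN lnK// posrE.
  rewrite -Rintegral_empirical//.
  have -> : (\int[Fhat]_y u y)%:E = (\int[Fhat]_y (u y)%:E)%E.
    by rewrite /Rintegral fineK//; exact: integrable_fin_num iu.
  rewrite -(Radon_Nikodym_change_of_variables dom measurableT
    (integrable_empirical mu_)).
  apply: le_integral_measurable.
  - by apply: emeasurable_funM => //; exact/measurable_EFinP.
  - exact/measurable_EFinP.
  - by move=> y; rewrite -/f -[f y]fineK// -EFinM lee_fin.
rewrite integral_empirical; last 2 first.
- exact: measurable_lne_fin.
- by move=> s; rewrite -[f _]fineK// lne_EFin.
rewrite lee_fin lerBlDr -lerBlDl -mulrBr -sumrB.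
rewrite -subr_le0 -(ler_pM2l c0) mulr0.
have avg_const (k : R) : t%:R^-1 * (\sum_(s < t) k) = k.
  by rewrite sumr_const card_ord -[k *+ t]mulr_natl mulrA mulVf ?mul1r// pnatr_eq0 -lt0n.
rewrite -(avg_const (ln (1 + nu * (mu - m)))).
rewrite -mulrBr -sumrB.
apply: (@le_trans _ _ (t%:R^-1 * (\sum_(s < t) wealth mu nu (x s) / fine (f (x s)))
   - (1 + nu * (mu - m)))); last by rewrite subr_le0.
rewrite -[X in _ <= _ - X](avg_const (1 + nu * (mu - m))).
rewrite -mulrBr -sumrB mulrCA ler_pM2l// mulr_sumr ler_sum// => s _.
rewrite -{1}[f (x s)]fineK// lne_EFin//=.
set c := 1 + nu * (mu - m) in c0 *.
set w := wealth mu nu (x s); set ff := fine _.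
have w0s : 0 < w by exact: w0.
have ff0 : 0 < ff by exact: f0.
have -> : ln w - ln ff - ln c = ln (w / ff / c) by rewrite !ln_div ?posrE ?divr_gt0.
have h : ln (w / ff / c) <= w / ff / c - 1.
  have := @le_ln1Dx _ (w / ff / c - 1); rewrite [1 + _]addrC subrK; apply.
  by rewrite ltrBrDl subrr !divr_gt0.
have -> : w / ff - c = c * (w / ff / c - 1) by field; rewrite !gt_eqF.
by rewrite ler_pM2l.
Qed.

End empirical.

Section empirical_upper.
Context (R : realType) (x : nat -> R) (t : nat).
Hypotheses (t0 : (0 < t)%N) (x1 : forall s : 'I_t, x s <= 1).
Local Notation Fhat := (empirical x t).

Definition grid_point (mu : R) (j : nat) : R := j%:R / t.+1%:R / (1 - mu).

(** The factor e times the total wealth of t + 2 gamblers with equally spaced stakes.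
    It is a finite sum of products of independent factors, whereas the best wealth
    in hindsight is not. *)
Definition grid_wealth (mu : R) : R :=
  expR 1 * \sum_(j < t.+2) \prod_(s < t) wealth mu (grid_point mu j) (x s).

Lemma wealth_grid_ge0 mu (j : 'I_t.+2) y : mu < 1 ->
  0 <= wealth mu (grid_point mu j) y.
Proof.
move=> mu1; have mu0 : 0 < 1 - mu by rewrite subr_gt0.
have g0 : 0 <= grid_point mu j by apply: divr_ge0; [exact: divr_ge0|exact: ltW].
apply: le_trans (wealth_ge mu y g0).
by rewrite divfK ?gt_eqF// subr_ge0 ler_pdivrMr ?ltr0n// mul1r ler_nat -ltnS.
Qed.

(** Every stake p / (1 - mu), p in [0, 1), can be mixed with weight 1 / (t + 1) with another stake
    so as to fall on the grid.  The wealth being affine and nonnegative in the stake,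
    this loses at most a factor (1 - 1 / (t + 1)) per round, hence at most e over
    t rounds. *)
Lemma prod_wealth_le_grid mu nu : mu < 1 -> 0 <= nu -> nu * (1 - mu) < 1 ->
  \prod_(s < t) wealth mu nu (x s) <= grid_wealth mu.
Proof.
move=> mu1 nu0 nu1.
have mu0 : 0 < 1 - mu by rewrite subr_gt0.
have tR : 0 < t%:R :> R by rewrite ltr0n.
pose p := nu * (1 - mu).
have p0 : 0 <= p by rewrite mulr_ge0// ltW.
have tp0 : 0 <= t%:R * p by rewrite mulr_ge0// ltW.
have /andP[jl jr] := truncn_itv tp0.
set j0 := Num.truncn _ in jl jr.
have j0t : (j0 < t.+1)%N.
  rewrite ltnS -(ler_nat R) (le_trans jl)// ger_pMr// ltW//.
pose j : 'I_t.+2 := Ordinal (j0t : (j0.+1 < t.+2)%N).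
have growth (s : 'I_t) : t%:R / t.+1%:R * wealth mu nu (x s) <=
    wealth mu (grid_point mu j) (x s).
  pose y := (Num.min (x s) 1 - mu) / (1 - mu).
  have y1 : y <= 1 by rewrite ler_pdivrMr// mul1r lerD2r ge_min lexx orbT.
  have -> : wealth mu nu (x s) = 1 - p * y.
    by rewrite /wealth /p /y; field; rewrite gt_eqF.
  have -> : wealth mu (grid_point mu j) (x s) = 1 - j0.+1%:R / t.+1%:R * y.
    by rewrite /wealth /grid_point /y /=; field; rewrite -?natr1 !gt_eqF//; lra.
  rewrite mulrAC ler_pdivrMr ?ltr0n//.
  have -> : (1 - j0.+1%:R / t.+1%:R * y) * t.+1%:R = t.+1%:R - j0.+1%:R * y.
    by field; rewrite gt_eqF//; lra.
  have k1 : j0.+1%:R - t%:R * p <= 1 by rewrite -natr1; lra.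
  have k0 : 0 <= j0.+1%:R - t%:R * p by lra.
  by move: k0 k1; rewrite -[t.+1%:R]natr1; set k := j0.+1%:R; nra.
have pow_t : 1 <= expR (1 : R) * (t%:R / t.+1%:R) ^+ t.
  have -> : (t%:R / t.+1%:R) ^+ t = ((1 + t%:R^-1) ^+ t)^-1 :> R.
    by rewrite -exprVn; congr (_ ^+ _); rewrite -natr1; field; rewrite !gt_eqF//; lra.
  rewrite ler_pdivlMr ?exprn_gt0 ?addr_gt0 ?invr_gt0// mul1r.
  have -> : expR 1 = expR (t%:R^-1 : R) ^+ t.
    by rewrite -expRM_natl mulfV// gt_eqF.
  by rewrite lerXn2r ?nnegrE ?expR_ge0 ?addr_ge0 ?invr_ge0 ?expR_ge1Dx.
have w0 (s : 'I_t) : 0 <= wealth mu nu (x s) by rewrite ltW// wealth_gt0.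
rewrite /grid_wealth (bigD1 j)//=.
apply: (@le_trans _ _ (expR 1 * (t%:R / t.+1%:R) ^+ t *
    \prod_(s < t) wealth mu nu (x s))).
  by rewrite ler_peMl// prodr_ge0.
rewrite -mulrA ler_pM2l ?expR_gt0// -[leLHS]addr0 lerD//; last first.
  by apply: sumr_ge0 => k _; apply: prodr_ge0 => s _; exact: wealth_grid_ge0.
have -> : (t%:R / t.+1%:R) ^+ t = \prod_(s < t) (t%:R / t.+1%:R) :> R.
  by rewrite prodr_const card_ord.
rewrite -big_split/=; apply: ler_prod => s _; rewrite growth andbT.
by rewrite mulr_ge0// divr_ge0.
Qed.

Lemma grid_wealth_ge1 mu : mu < 1 -> 1 <= grid_wealth mu.
Proof.
move=> mu1; apply: le_trans (prod_wealth_le_grid mu1 (lexx 0) _).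
  by rewrite big1// => s _; rewrite /wealth mul0r subr0.
by rewrite mul0r.
Qed.

Let empirical_integrable_id : Fhat.-integrable setT EFin.
Proof. exact: (integrable_empirical x t (h := id)). Qed.

Lemma Dinf_empirical_le_grid mu : mu < 1 ->
  (Dinf Fhat mu <= (t%:R^-1 * ln (grid_wealth mu))%:E)%E.
Proof.
move=> mu1; apply/lee_addgt0Pr => eta eta0.
have [nu [nu0 nu1 _ Dle]] := Dinf_duality (empirical_setT x t0)
  (empirical_le1 t0 x1) empirical_integrable_id mu1 eta0.
rewrite (le_trans Dle)// -EFinD lee_fin lerD2r.
have mlnw : measurable_fun setT (fun y => ln (wealth mu nu y)).
  by apply: measurableT_comp; [exact: measurable_ln|exact: measurable_wealth].
rewrite Rintegral_empirical// ler_pM2l ?invr_gt0 ?ltr0n//.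
have w0 (s : 'I_t) : 0 < wealth mu nu (x s) by rewrite wealth_gt0.
have -> : \sum_(s < t) ln (wealth mu nu (x s)) =
    ln (\prod_(s < t) wealth mu nu (x s)).
  apply: expR_inj; rewrite expR_sum lnK ?posrE ?prodr_gt0//.
  by apply: eq_bigr => s _; rewrite lnK// posrE.
rewrite ler_ln ?posrE ?prodr_gt0//; first exact: prod_wealth_le_grid.
by rewrite (lt_le_trans ltr01)// grid_wealth_ge1.
Qed.

(** As ln w <= w - 1, no stake yields growth in the game that is fair for the
    empirical mean. *)
Lemma Dinf_empirical_empmean : empmean x t < 1 ->
  (Dinf Fhat (empmean x t) <= 0)%E.
Proof.
move=> mu1; apply/lee_addgt0Pr => eta eta0.
have Fhat1 := empirical_setT x t0.
have Fhatle1 := empirical_le1 t0 x1.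
have [nu [nu0 nu1 _ Dle]] := Dinf_duality Fhat1 Fhatle1
  empirical_integrable_id mu1 eta0.
rewrite (le_trans Dle)// add0e lee_fin gerDr.
set mu := empmean x t in mu1 nu1 *.
have iw := @integrable_wealth _ _ empirical_integrable_id mu nu.
have -> : 0 = \int[Fhat]_y (wealth mu nu y - 1).
  rewrite RintegralB//; last exact: finite_measure_integrable_cst.
  rewrite Rintegral_wealth// Rintegral_cst1// Rintegral_empirical//.
  by rewrite [_^-1 * _]mulrC -/(empmean x t) -/mu; ring.
apply: le_Rintegral => //.
- exact: integrable_ln_wealth.
- exact: (integrableB measurableT iw (finite_measure_integrable_cst _ 1 measurableT)).
- move=> y _; have := @le_ln1Dx _ (wealth mu nu y - 1).
  rewrite [1 + _]addrC subrK; apply.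
  by rewrite ltrBrDl subrr wealth_gt0.
Qed.

End empirical_upper.

(** * Counting insertions into the list of the next loop *)

Section policy_counts.
Context (R : realType) (K : nat) (r : R) (x : 'I_K -> nat -> R).
Local Notation st := (dmed_loop r x).
Local Notation round := (dmed_round r x).

Arguments dmed_loop : simpl never.

Implicit Types (n m t : nat) (a i j k : 'I_K) (s : state K).

Lemma pulls_round n a s j :
  pulls (round n a s) j = (pulls s j + (j == a))%N.
Proof. by rewrite /dmed_round; case: ifP. Qed.

Definition wanted n a s j := J' r x (pulls (round n a s)) n j.

Let joins n a s j := (j \notin LR s :\ a) && wanted n a s j.

Let pulls_roundE n a s :
  pulls (round n a s) = fun j => (pulls s j + (j == a))%N.
Proof. by apply/funext => j; exact: pulls_round. Qed.

Lemma in_LR_round n a s j : (j \in LR (round n a s)) =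
  if LR s :\ a == finset.set0 then (j \in LN s) || joins n a s j
  else j \in LR s :\ a.
Proof.
rewrite /joins /wanted pulls_roundE /dmed_round.
by case: ifP => //= _; rewrite !inE.
Qed.

Lemma in_LN_round n a s j : (j \in LN (round n a s)) =
  (LR s :\ a != finset.set0) && ((j \in LN s) || joins n a s j).
Proof.
rewrite /joins /wanted pulls_roundE /dmed_round.
by case: ifP => //= _; rewrite !inE.
Qed.

Definition newly_listed n a s i := (i \notin LN s) && joins n a s i.

(** Insertions of arm i into the list of the next loop, at round K + m + 1.  As an arm
    can only be pulled when listed, they are what has to be counted. *)
Definition insertion m i : bool :=
  if enum (LR (st m)) is a :: _ then newly_listed (K + m.+1) a (st m) i
  else false.

Lemma dmed_loopS m : (LR (st m) = finset.set0 /\ st m.+1 = st m) \/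
  exists2 a, a \in LR (st m) &
    st m.+1 = round (K + m.+1) a (st m) /\
    forall i, insertion m i = newly_listed (K + m.+1) a (st m) i.
Proof.
have stE : st m.+1 = if enum (LR (st m)) is a :: _
  then round (K + m.+1) a (st m) else st m by [].
rewrite /insertion stE; case E : (enum (LR (st m))) => [|a e].
  left; split; last by [].
  apply/finset.setP => j; rewrite inE.
  by apply/negP => jLR; have := mem_enum (LR (st m)) j; rewrite E jLR.
right; exists a => //.
by rewrite -mem_enum E mem_head.
Qed.

Lemma insertionF m i : LR (st m) = finset.set0 -> insertion m i = false.
Proof.
move=> LR0; rewrite /insertion.
by case E : (enum (LR (st m))) => [//|a e]; have := mem_enum (LR (st m)) a;
  rewrite E mem_head LR0 inE.
Qed.

Lemma pulls_gt0 m j : (0 < pulls (st m) j)%N.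
Proof.
elim: m => [//|m IH]; have [[_ ->]//|[a aLR [-> _]]] := dmed_loopS m.
by rewrite pulls_round addn_gt0 IH.
Qed.

Lemma pulls_leS m j : (pulls (st m) j <= m.+1)%N.
Proof.
elim: m => [//|m IH]; have [[_ ->]|[a aLR [-> _]]] := dmed_loopS m.
  exact: leqW.
by rewrite pulls_round -[m.+2]addn1 leq_add// leq_b1.
Qed.

(** Each insertion entitles the arm to one more pull.  The number of pulls plus the
    number of lists containing i is invariant except that it increases by one at
    an insertion; initially it is 2. *)
Lemma pulls_le_insertions m i :
  (pulls (st m) i <= 2 + \sum_(m' < m) insertion m' i)%N.
Proof.
suff : (pulls (st m) i + (i \in LR (st m)) + (i \in LN (st m)) <=
    2 + \sum_(m' < m) insertion m' i)%N.
  by apply: leq_trans; rewrite -addnA leq_addr.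
elim: m => [|m IH]; first by rewrite big_ord0 /= !inE.
rewrite big_ord_recr/=; have [[LR0 stE]|[a aLR [stE insE]]] := dmed_loopS m.
  by rewrite stE (insertionF _ LR0) addn0.
rewrite stE insE pulls_round in_LR_round in_LN_round /newly_listed.
move: IH.
have -> : (i \in LR (st m)) = (i == a) || (i \in LR (st m) :\ a).
  by rewrite !inE; case: eqP => [->|].
have : (i == a) && (i \in LR (st m) :\ a) = false.
  by rewrite !inE; case: eqP.
have : (LR (st m) :\ a == finset.set0) ==> (i \notin LR (st m) :\ a).
  by apply/implyP => /eqP ->; rewrite inE.
rewrite /joins.
case: (i == a); case: (i \in LR (st m) :\ a); case: (i \in LN (st m));
  case: (_ == finset.set0); case: (wanted _ _ _ _) => //=; lia.
Qed.

(** After an insertion, the arm stays listed until it is pulled again. *)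
Lemma insertions_own_pulls m i t :
  (\sum_(m' < m) (insertion m' i && (pulls (st m'.+1) i == t)) <= 1)%N.
Proof.
suff : (\sum_(m' < m) (insertion m' i && (pulls (st m'.+1) i == t)) <=
    (t < pulls (st m) i) +
    ((t == pulls (st m) i) && ((i \in LR (st m)) || (i \in LN (st m)))))%N.
  move=> /leq_trans; apply; case: (ltngtP t (pulls (st m) i)) => //= _.
  exact: leq_b1.
elim: m => [|m IH]; first by rewrite big_ord0.
rewrite big_ord_recr/=; have [[LR0 stE]|[a aLR [stE insE]]] := dmed_loopS m.
  by rewrite (insertionF _ LR0) addn0 stE.
rewrite stE insE pulls_round in_LR_round in_LN_round /newly_listed.
move: IH; set c := (\sum_(m' < m) _)%N.
have : (i == a) ==> (i \in LR (st m)) by apply/implyP => /eqP ->.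
have -> : (i \in LR (st m)) = (i == a) || (i \in LR (st m) :\ a).
  by rewrite !inE; case: eqP => [->|].
have : (i == a) && (i \in LR (st m) :\ a) = false.
  by rewrite !inE; case: eqP.
have : (LR (st m) :\ a == finset.set0) ==> (i \notin LR (st m) :\ a).
  by apply/implyP => /eqP ->; rewrite inE.
rewrite /joins.
case: (i == a); case: (i \in LR (st m) :\ a); case: (i \in LN (st m));
  case: (_ == finset.set0); case: (wanted _ _ _ _) => //=; lia.
Qed.

(** When i is inserted while k satisfies the test, k has still to be pulled in the
    current loop, or will be pulled in the next one.  During this time i can be
    inserted at most once more, namely in the next loop before k is reached. *)
Lemma insertions_listed_pulls m i k t :
  (\sum_(m' < m) [&& insertion m' i, pulls (st m'.+1) k == t &
     J' r x (pulls (st m'.+1)) (K + m'.+1) k] <= 2)%N.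
Proof.
(* c is the number of insertions so far with k at t pulls. *)
pose inv c s := if (t < pulls s k)%N then (c <= 2)%N
  else if (pulls s k < t)%N then c == 0%N
  else [|| c == 0%N, (c <= 1)%N && ((k \in LR s) || (k \in LN s) && (i \in LN s)) |
    [&& (c <= 2)%N, k \in LR s & i \in LN s]].
suff : inv (\sum_(m' < m) [&& insertion m' i, pulls (st m'.+1) k == t &
    J' r x (pulls (st m'.+1)) (K + m'.+1) k])%N (st m).
  rewrite /inv; case: ltngtP => //.
  - by move=> _ /eqP ->.
  - by move=> _ /or3P[/eqP ->//|/andP[/leq_trans-> //]|/and3P[]].
elim: m => [|m IH]; first by rewrite big_ord0 /inv; case: ltngtP.
rewrite big_ord_recr/=; have [[LR0 stE]|[a aLR [stE insE]]] := dmed_loopS m.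
  by rewrite (insertionF _ LR0) addn0 stE.
rewrite insE stE.
move: IH; set c := (\sum_(m' < m) _)%N.
rewrite -/(wanted (K + m.+1) a (st m) k) /inv pulls_round !in_LR_round.
rewrite !in_LN_round /newly_listed /joins.
have : (k == a) ==> (k \in LR (st m)) by apply/implyP => /eqP ->.
have -> : (k \in LR (st m)) = (k == a) || (k \in LR (st m) :\ a).
  by rewrite !inE; case: eqP => [->|].
have : (k == a) && (k \in LR (st m) :\ a) = false.
  by rewrite !inE; case: eqP.
have : (LR (st m) :\ a == finset.set0) ==> (i \notin LR (st m) :\ a).
  by apply/implyP => /eqP ->; rewrite inE.
have : (LR (st m) :\ a == finset.set0) ==> (k \notin LR (st m) :\ a).
  by apply/implyP => /eqP ->; rewrite inE.
move: (pulls (st m) k) => p; case: (k == a); rewrite ?addn1 ?addn0.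
  case: (k \in LR (st m) :\ a) => //=.
  have [tp|pt|tp] := ltngtP t p.
  - by rewrite ltnS (ltnW tp) (gtn_eqF (leqW tp))//= ?andbF ?addn0// ltnS ltnW.
  - move=> _ _ _ _ /eqP ->; rewrite ltnS leqNgt pt/= add0n.
    have [pt'|pt'|pt'] := ltngtP p.+1 t; [by rewrite /= ?andbF| |].
      by move: pt'; rewrite ltnS leqNgt pt.
    case: (i \in LR (st m) :\ a);
    case: (i \in LN (st m)); case: (k \in LN (st m));
    case: (_ == finset.set0); case: (wanted _ _ _ i);
    by case: (wanted _ _ _ k).
  - rewrite tp ltnS leqnn (gtn_eqF (ltnSn p))/= ?andbF ?addn0.
    by move=> _ _ _ _ /or3P[/eqP -> //|/andP[/leq_trans-> //]|/andP[]].
move=> + + _ _; rewrite [p == t]eq_sym.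
case: (ltngtP t p) => [tp|pt|tp] //=; rewrite ?andbF ?addn0//.
case: (k \in LR (st m) :\ a); case: (i \in LR (st m) :\ a);
  case: (i \in LN (st m)); case: (k \in LN (st m));
  case: (_ == finset.set0); case: (wanted _ _ _ i); case: (wanted _ _ _ k) => //=;
  rewrite ?andbF ?andbT ?orbF ?orbT ?addn0; lia.
Qed.

End policy_counts.

(** * Pathwise bound on the number of pulls *)

Lemma maxin_witness (R : realType) (K : nat) (A : {set 'I_K}) (f : 'I_K -> R)
    (k0 : 'I_K) : k0 \in A ->
  exists2 k, k \in A & maxin A f = f k /\ forall j, j \in A -> f j <= f k.
Proof.
move=> k0A; have [k kA kmax] := @arg_maxP _ R _ k0 (mem A) f k0A.
exists k => //; split; last by move=> j /kmax.
rewrite /maxin; suff -> : \big[maxe/-oo%E]_(i in A) (f i)%:E = (f k)%:E by [].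
apply/eqP; rewrite eq_le; apply/andP; split.
  by apply/bigmax_leP; split => [|j jA]; rewrite ?leNye// lee_fin; exact: kmax.
exact: (le_bigmax_cond _ (fun j => (f j)%:E)).
Qed.

Lemma count_le_real (R : realType) (p : nat -> bool) (y : R) (m : nat) : 0 <= y ->
  (forall t, p t -> t.+1%:R <= y) -> (\sum_(t < m) p t)%:R <= y.
Proof.
move=> y0 py; elim: m => [|m IH]; first by rewrite big_ord0.
rewrite big_ord_recr/=; case: (boolP (p m)) => [pm|_]; last by rewrite addn0.
apply: le_trans (py _ pm); rewrite ler_nat addn1 ltnS.
rewrite -[leqRHS]card_ord -sum1_card; apply: leq_sum => t _; exact: leq_b1.
Qed.

(** Turns a count over rounds into a count over the number of pulls of one arm,
    which is where the empirical distribution depends on the rewards only. *)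
Lemma sum_by_value (m N c : nat) (P Q : nat -> bool) (T : nat -> nat) :
  (forall m', (m' < m)%N -> (0 < T m' <= N)%N) ->
  (forall t, (\sum_(m' < m) (P m' && (T m' == t)) <= c)%N) ->
  (\sum_(m' < m) (P m' && Q (T m')) <= \sum_(t < N) c * Q t.+1)%N.
Proof.
move=> Tb Pc.
apply: (@leq_trans (\sum_(m' < m) \sum_(t < N) (Q t.+1) * (P m' && (T m' == t.+1)))).
  apply: leq_sum => m' _; case: (boolP (P m')) => //= Pm'.
  have /andP[T0 TN] := Tb m' (ltn_ord m').
  have TN' : ((T m').-1 < N)%N by rewrite prednK.
  by rewrite (bigD1 (Ordinal TN'))//= prednK// eqxx muln1 leq_addr.
rewrite exchange_big/=; apply: leq_sum => t _; rewrite -big_distrr/= mulnC.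
by rewrite leq_mul2r Pc orbT.
Qed.

Section pathwise.
Context (R : realType) (K : nat) (r : R) (x : 'I_K -> nat -> R).
Hypotheses (r01 : 0 < r < 1) (x1 : forall k s, x k s <= 1).
Local Notation st := (dmed_loop r x).
Local Notation J' := (J' r x).

Lemma Dinf_mono (F : {finite_measure set R -> \bar R}) (a b : R) :
  a <= b -> (Dinf F a <= Dinf F b)%E.
Proof.
move=> ab; apply: ereal_inf_le_tmp => _ [G [G1 bG] <-]; exists G => //; split => //.
by rewrite (le_lt_trans _ bG)// lee_fin.
Qed.

(** The arm with the best empirical mean always passes the test, its empirical Dinf
    being 0. *)
Lemma J'_best (T : 'I_K -> nat) n k : (0 < T k)%N -> (0 < n)%N ->
  best_empmean x T = empmean (x k) (T k) -> best_empmean x T < 1 -> J' T n k.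
Proof.
move=> Tk n0 bE b1; rewrite /Defs.J' bE; rewrite bE in b1.
apply: (@le_trans _ _ 0%E).
  rewrite mule_ge0_le0//; last exact: (Dinf_empirical_empmean Tk (fun s => x1 k s) b1).
  by rewrite lee_fin mulr_ge0// subr_ge0; case/andP: r01 => _ /ltW.
by rewrite lee_fin ln_ge0// ler1n.
Qed.

Variables (opt : {set 'I_K}) (i k0 : 'I_K) (lo hi d0 : R) (N : nat).
Hypotheses (lo1 : lo < 1) (hi1 : hi < 1) (d00 : 0 < d0) (N0 : (0 < N)%N).

Definition misleading k t : bool :=
  if k \in opt then empmean (x k) t <= lo else hi <= empmean (x k) t.

Definition underestimated t : bool := empmean (x k0) t <= hi.

(* The test for arm i, relaxed to lo instead of the best empirical mean. *)
Let close t : bool :=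
  (((1 - r) * t%:R)%:E * Dinf (empirical (x i) t) lo <= (ln N%:R)%:E)%E.

Let T m := pulls (st m.+1).

Let pos4 (a b c e : nat) :
  [|| 0 < a, 0 < b, 0 < c | 0 < e]%N -> (0 < a + b + c + e)%N.
Proof. lia. Qed.

(** If the best empirical mean is at least lo, the test for i is a test against lo.
    Otherwise let k be the best arm.  If it is misleading, count it with its test, which
    succeeds.  If not, k is not in opt and the best mean is below hi, so that k0
    is underestimated; either k0 passes its test too, or its failure bounds the
    current round by a power of the grid wealth. *)
Let cases m : (K + m.+1 <= N)%N ->
  (insertion r x m i <= (insertion r x m i && close (T m i)) +
    \sum_k [&& insertion r x m i, J' (T m) (K + m.+1) k & misleading k (T m k)] +
    [&& insertion r x m i, J' (T m) (K + m.+1) k0 & underestimated (T m k0)] +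
    [&& ((K + m.+1)%:R <= grid_wealth (x k0) (T m k0) hi `^ (1 - r))%R &
       underestimated (T m k0)])%N.
Proof.
move=> mN; case: (boolP (insertion r x m i)) => //= ins.
have JTi : J' (T m) (K + m.+1) i.
  have [[LR0 _]|[a aLR [stE insE]]] := dmed_loopS r x m.
    by rewrite (insertionF _ LR0) in ins.
  move: ins; rewrite insE => /and3P[_ _].
  by rewrite /wanted -stE.
have n0 : (0 < K + m.+1)%N by rewrite addnS.
have [k _ [bestk bestmax]] := @maxin_witness R K [set: 'I_K]%SET
  (fun j => empmean (x j) (T m j)) i (finset.in_setT _).
rewrite -/(best_empmean x (T m)) in bestk.
have r1 : 0 < 1 - r by case/andP: r01 => _; rewrite subr_gt0.
have [lob|blo] := leP lo (best_empmean x (T m)).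
  suff -> : close (T m i) by apply: pos4.
  rewrite /close; apply: (@le_trans _ _ (((1 - r) * (T m i)%:R)%:E *
      Dinf (empirical (x i) (T m i)) (best_empmean x (T m)))%E).
    apply: lee_wpmul2l; last exact: Dinf_mono.
    by rewrite lee_fin mulr_ge0// ltW.
  by apply: (le_trans JTi); rewrite lee_fin ler_ln ?posrE ?ltr0n// ler_nat.
have J'k : J' (T m) (K + m.+1) k.
  by apply: J'_best => //; [exact: pulls_gt0|exact: lt_trans blo lo1].
have [badk|] := boolP (misleading k (T m k)).
  by apply: pos4; rewrite (bigD1 k)//= J'k badk !orbT.
rewrite /misleading -bestk; case: ifPn => kopt; first by rewrite (ltW blo).
rewrite -ltNge => bhi.
have k0le : empmean (x k0) (T m k0) <= best_empmean x (T m).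
  by rewrite bestk; apply: bestmax; rewrite finset.in_setT.
have -> : underestimated (T m k0).
  by rewrite /underestimated (le_trans k0le)// ltW.
rewrite !andbT; have [_|J'k0] := boolP (J' (T m) (K + m.+1) k0).
  by apply: pos4; rewrite /= !orbT.
suff -> : (K + m.+1)%:R <= grid_wealth (x k0) (T m k0) hi `^ (1 - r).
  by apply: pos4; rewrite /= !orbT.
have T0 : (0 < T m k0)%N by exact: pulls_gt0.
have gw1 := grid_wealth_ge1 (x k0) T0 hi1.
have gw0 : 0 < grid_wealth (x k0) (T m k0) hi by rewrite (lt_le_trans ltr01).
rewrite -ler_ln ?posrE ?ltr0n ?powR_gt0// ln_powR.
move: J'k0; rewrite /Defs.J' -ltNge => /ltW lnle.
have := le_trans lnle (lee_wpmul2l _ (le_trans (Dinf_mono _ (ltW bhi))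
  (Dinf_empirical_le_grid T0 (fun s => x1 k0 s) hi1))).
rewrite lee_fin => /(_ (mulr_ge0 (ltW r1) (ler0n _ _))).
rewrite -EFinM lee_fin => /le_trans; apply.
rewrite -mulrA ler_pM2l// mulrA mulfV ?mul1r// pnatr_eq0.
by rewrite -lt0n.
Qed.

Let pad2 (a b c e : R) : 0 <= a -> 0 <= b + c + e -> 2 <= 2 + a + b + c + e.
Proof. lra. Qed.

Let add4 (a b b' c e f g h : R) : c <= a + g -> b <= b' -> e + f <= h ->
  2 + (c + b + e + f) <= 2 + a + g + b' + h.
Proof. lra. Qed.

(** The previous decomposition regrouped by numbers of pulls.  The summand
    ln N / ((1 - r) d0) bounds the number of t for which the test can succeed while
    Dinf is at least d0. *)
Lemma dmed_pulls_le :
  (dmed_pulls r x N i)%:R <= 2 + ln N%:R / ((1 - r) * d0) +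
    \sum_(t < N) ((Dinf (empirical (x i) t.+1) lo < d0%:E)%E : nat)%:R +
    \sum_k \sum_(t < N) 2 * (misleading k t.+1)%:R +
    \sum_(t < N) (underestimated t.+1)%:R *
      (2 + grid_wealth (x k0) t.+1 hi `^ (1 - r)).
Proof.
have r1 : 0 < 1 - r by case/andP: r01 => _; rewrite subr_gt0.
have thr0 : 0 <= ln N%:R / ((1 - r) * d0).
  by rewrite divr_ge0 ?ln_ge0 ?ler1n// mulr_ge0// ltW.
have rest0 : 0 <= \sum_(t < N) ((Dinf (empirical (x i) t.+1) lo < d0%:E)%E : nat)%:R +
    \sum_k \sum_(t < N) 2 * (misleading k t.+1)%:R +
    \sum_(t < N) (underestimated t.+1)%:R *
      (2 + grid_wealth (x k0) t.+1 hi `^ (1 - r)) :> R.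
  rewrite !addr_ge0 ?sumr_ge0// => j _; first by rewrite sumr_ge0.
  by rewrite mulr_ge0// addr_ge0// powR_ge0.
rewrite /dmed_pulls; case: (leqP N K) => [NK|KN].
  apply: (@le_trans _ _ 2%:R); first by rewrite ler_nat; case: (i < N)%N.
  exact: pad2.
set M := (N - K)%N.
have K0 : (0 < K)%N by case: K i => [[]//|].
have Tb m' k : (m' < M)%N -> (0 < T m' k <= N)%N.
  move=> m'M; rewrite pulls_gt0 (leq_trans (pulls_leS _ _ _ _))//.
  by rewrite /M in m'M; lia.
have main : (pulls (st M) i <= 2 +
    (\sum_(t < N) close t.+1 +
     \sum_k \sum_(t < N) 2 * misleading k t.+1 +
     \sum_(t < N) 2 * underestimated t.+1 +
     \sum_(m' < M) [&& ((K + m'.+1)%:R <= grid_wealth (x k0) (T m' k0) hi `^ (1 - r))%R &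
       underestimated (T m' k0)]))%N.
  apply: (leq_trans (pulls_le_insertions r x M i)); rewrite leq_add2l.
  apply: (@leq_trans (\sum_(m' < M) _)%N).
    by apply: leq_sum => m' _; apply: cases; have := ltn_ord m'; rewrite /M; lia.
  rewrite big_split [X in (X + _ <= _)%N]big_split.
  rewrite [X in (X + _ + _ <= _)%N]big_split /=.
  apply: leq_add => //; apply: leq_add; last first.
    under eq_bigr do rewrite andbA.
    apply: (@sum_by_value M N 2 (fun m' => insertion r x m' i &&
      J' (T m') (K + m'.+1) k0) underestimated (T ^~ k0)); first by move=> m'; exact: Tb.
    move=> t; rewrite (leq_trans _ (insertions_listed_pulls r x M i k0 t))//.
    by apply: leq_sum => m' _; rewrite /T -andbA [X in _ && X]andbC.
  apply: leq_add.
    have -> : (\sum_(t < N) close t.+1 = \sum_(t < N) 1 * close t.+1)%N.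
      by apply: eq_bigr => t _; rewrite mul1n.
    apply: (@sum_by_value M N 1 (fun m' => insertion r x m' i) close (T ^~ i)); first by move=> m'; exact: Tb.
    by move=> t; exact: insertions_own_pulls.
  rewrite exchange_big/=; apply: leq_sum => k _.
  under eq_bigr do rewrite andbA.
  apply: (@sum_by_value M N 2 (fun m' => insertion r x m' i &&
    J' (T m') (K + m'.+1) k) (misleading k) (T ^~ k)); first by move=> m'; exact: Tb.
  move=> t; rewrite (leq_trans _ (insertions_listed_pulls r x M i k t))//.
  by apply: leq_sum => m' _; rewrite /T -andbA [X in _ && X]andbC.
have closeD : (\sum_(t < N) close t.+1)%:R <= ln N%:R / ((1 - r) * d0) +
    \sum_(t < N) ((Dinf (empirical (x i) t.+1) lo < d0%:E)%E : nat)%:R.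
  pose p t := close t.+1 && ~~ (Dinf (empirical (x i) t.+1) lo < d0%:E)%E.
  apply: (@le_trans _ _ ((\sum_(t < N) p t) +
      \sum_(t < N) ((Dinf (empirical (x i) t.+1) lo < d0%:E)%E : nat))%:R).
    rewrite ler_nat -big_split/=; apply: leq_sum => t _; rewrite /p.
    by case: (close _); case: (_ < _)%E.
  rewrite natrD; apply: lerD; last by rewrite natr_sum.
  apply: (@count_le_real _ p) => // t.
  rewrite /p -leNgt => /andP[cl Dge].
  rewrite ler_pdivlMr ?mulr_gt0// mulrA [t.+1%:R * _]mulrC.
  rewrite -lee_fin (le_trans _ cl)// EFinM lee_wpmul2l//.
  by rewrite lee_fin mulr_ge0// ltW.
have counted : (\sum_(m' < M)
     [&& ((K + m'.+1)%:R <= grid_wealth (x k0) (T m' k0) hi `^ (1 - r))%R &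
       underestimated (T m' k0)])%:R <=
   \sum_(t < N) (underestimated t.+1)%:R * grid_wealth (x k0) t.+1 hi `^ (1 - r).
  apply: (@le_trans _ _ (\sum_(t < N) underestimated t.+1 *
      \sum_(m' < M) ((K + m'.+1)%:R <= grid_wealth (x k0) t.+1 hi `^ (1 - r))%R)%:R).
    rewrite ler_nat; under [leqRHS]eq_bigr do rewrite big_distrr/=.
    rewrite exchange_big/=; apply: leq_sum => m' _.
    have /andP[T0 TN] := Tb m' k0 (ltn_ord m').
    have TN' : ((T m' k0).-1 < N)%N by rewrite prednK.
    rewrite (bigD1 (Ordinal TN'))//= prednK//.
    by case: (_ <= _)%R; case: (underestimated _).
  rewrite natr_sum; apply: ler_sum => t _; rewrite natrM ler_wpM2l//.
  apply: (count_le_real (p := fun m' =>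
    (K + m'.+1)%:R <= grid_wealth (x k0) t.+1 hi `^ (1 - r))).
    exact: powR_ge0.
  by move=> m'; apply: le_trans; rewrite ler_nat leq_addl.
move: main; rewrite -(ler_nat R) => /le_trans; apply.
rewrite !natrD; apply: add4; first exact: closeD.
  rewrite natr_sum; apply: ler_sum => k _; rewrite natr_sum.
  by apply: ler_sum => t _; rewrite natrM.
under [leRHS]eq_bigr do rewrite mulrDr.
rewrite [leRHS]big_split/=; apply: lerD; last exact: counted.
by rewrite natr_sum; apply: ler_sum => t _; rewrite natrM mulrC.
Qed.
End pathwise.

(** * Inequalities for the exponential *)

Section exp_bounds.
Context (R : realType).
Implicit Types (u v theta lam w : R).

(** Compare the power series term by term: theta ^ k <= theta ^ 2 for k >= 2. *)
Lemma expR_remainder_scale theta u : 0 <= theta <= 1 ->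
  expR (theta * u) - 1 - theta * u <= theta ^+ 2 * (expR `|u| - 1 - `|u|).
Proof.
move=> /andP[th0 th1]; rewrite -subr_ge0.
pose D n := theta ^+ 2 * series (exp_coeff `|u|) n - series (exp_coeff (theta * u)) n.
have cvgD : D n @[n --> \oo] --> theta ^+ 2 * expR `|u| - expR (theta * u).
  by apply: cvgB; [apply: cvgMr|]; exact: is_cvg_series_exp_coeff.
have DS n : D n.+1 = D n + (theta ^+ 2 * `|u| ^+ n - (theta * u) ^+ n) / n`!%:R.
  by rewrite /D !seriesSr /exp_coeff/=; ring.
have D2 n : theta ^+ 2 * (1 + `|u|) - 1 - theta * u <= D n.+2.
  elim: n => [|n IH].
    rewrite !DS {1}/D /series/= !big_geq// !expr0 !expr1 fact0 !divr1 !mulr0.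
    by rewrite le_eqVlt; apply/orP; left; apply/eqP; ring.
  rewrite DS -[leLHS]addr0; apply: lerD => //.
  rewrite mulr_ge0 ?invr_ge0// subr_ge0.
  rewrite (le_trans (ler_norm _))// normrX normrM exprMn ger0_norm//.
  rewrite ler_wpM2r ?exprn_ge0//.
  by rewrite ler_wiXn2l.
suff : theta ^+ 2 * (1 + `|u|) - 1 - theta * u <= theta ^+ 2 * expR `|u| - expR (theta * u).
  by move=> h; lra.
rewrite -(cvg_lim _ cvgD)//; apply: limr_ge; first by apply/cvg_ex; eexists; exact: cvgD.
by exists 2%N => // -[|[|n]] //= _; exact: D2.
Qed.

Lemma expR_le_quadratic theta u : `|theta| <= 1 ->
  expR (theta * u) <= 1 + theta * u + theta ^+ 2 * (expR u + expR (- u)).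
Proof.
move=> th1.
have remainder_le : expR `|u| - 1 - `|u| <= expR u + expR (- u).
  have := normr_ge0 u; have := expR_gt0 u; have := expR_gt0 (- u).
  by case: (ger0P u) => _ e1 e2 u0; lra.
have := ler_wpM2l (sqr_ge0 theta) remainder_le.
suff : expR (theta * u) - 1 - theta * u <= theta ^+ 2 * (expR `|u| - 1 - `|u|).
  by lra.
have [th0|th0] := leP 0 theta.
  by apply: expR_remainder_scale; rewrite th0 -[X in X <= _]ger0_norm.
rewrite -mulrNN -(normrN u) -(sqrrN theta); apply: expR_remainder_scale.
by rewrite oppr_ge0 (ltW th0) -ltr0_norm.
Qed.

Lemma expR_ge_quadratic v : 0 <= v -> 1 + v + v ^+ 2 / 2 <= expR v.
Proof.
move=> v0.
have S3 n : 1 + v + v ^+ 2 / 2 <= series (exp_coeff v) n.+3.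
  elim: n => [|n IH].
    rewrite /series/= !big_nat_recr//= !big_geq// /exp_coeff/=.
    by rewrite expr0 expr1 fact0 !factS fact0 !muln1 !divr1 add0r.
  rewrite seriesSr -[leLHS]addr0; apply: lerD => //.
  by rewrite /exp_coeff/= divr_ge0// exprn_ge0.
apply: limr_ge; first exact: is_cvg_series_exp_coeff.
by exists 3%N => // -[|[|[|n]]] //= _; exact: S3.
Qed.

Lemma expRN_le_quadratic v : 0 <= v -> expR (- v) <= 1 - v + v ^+ 2 / 2.
Proof.
move=> v0; have ev := expR_ge_quadratic v0.
rewrite expRN -[leLHS]mul1r ler_pdivrMr ?expR_gt0//.
have q0 : 0 <= 1 - v + v ^+ 2 / 2 by nra.
apply: le_trans (ler_wpM2l q0 ev).
have := sqr_ge0 (v ^+ 2); nra.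
Qed.

(** Second-order bound on the moment generating function of the logarithm of the
    wealth, in terms of the expectations of w and 1 / w.  For w >= 1 the remainder is at
    most the square term, and (ln w) ^ 2 <= w.  For w < 1 it is compared with the
    remainder at lam = 1 / 2, that is with s - 1 - ln s for s = w ^ (-1/2). *)
Lemma expRN_ln_le lam w : 0 < lam <= 1 / 2 -> 0 < w ->
  expR (- lam * ln w) <= 1 - lam * ln w + lam ^+ 2 / 2 * (2 * w^-1 + w).
Proof.
move=> /andP[lam0 lam1] w0.
have wV0 : 0 < w^-1 by rewrite invr_gt0.
have [w1|w1] := leP 1 w.
  have y0 : 0 <= ln w by exact: ln_ge0.
  have yw : (ln w) ^+ 2 <= w.
    have h2 : 0 <= ln w / 2 by lra.
    have e2 := expR_ge_quadratic h2.
    have wE : expR (ln w / 2) ^+ 2 = w.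
      by rewrite -expRM_natl mulrC divfK ?lnK// posrE.
    rewrite -[leRHS]wE lerXn2r ?nnegrE ?expR_ge0//; apply: le_trans e2.
    by have := sqr_ge0 (ln w - 2); nra.
  rewrite mulNr; apply: le_trans (expRN_le_quadratic (mulr_ge0 (ltW lam0) y0)) _.
  rewrite lerD2l exprMn mulrAC ler_wpM2l ?divr_ge0 ?sqr_ge0//; lra.
set z := - ln w.
have z0 : 0 < z by rewrite oppr_gt0 ln_lt0// w0.
pose s := expR (z / 2).
have s1 : 1 <= s by rewrite -expR0 ler_expR; lra.
have s0 : 0 < s by exact: expR_gt0.
have sE : s ^+ 2 = w^-1.
  by rewrite -expRM_natl mulrC divfK// /z -lnV ?posrE// lnK ?posrE.
have zs : 1 - s^-1 <= z / 2.
  by rewrite /s -expRN; have := expR_ge1Dx (- (z / 2)); lra.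
have := @expR_remainder_scale (2 * lam) (z / 2).
have -> : 2 * lam * (z / 2) = - lam * ln w by rewrite /z; field.
rewrite gtr0_norm ?divr_gt0// -/s => /(_ _).
have -> : 0 <= 2 * lam <= 1 by apply/andP; split; lra.
move=> /(_ isT) rem.
have key : 4 * (s - 1 - z / 2) <= s ^+ 2.
  apply: (@le_trans _ _ (4 * (s - 2 + s^-1))); first by lra.
  rewrite -(ler_pM2l s0).
  have -> : s * (4 * (s - 2 + s^-1)) = 4 * (s - 1) ^+ 2 by field; rewrite gt_eqF.
  have s10 : 0 <= s - 1 by lra.
  by have := mulr_ge0 s10 (sqr_ge0 (s - 3 / 2)); nra.
have l20 : 0 <= lam ^+ 2 by exact: sqr_ge0.
have := ler_wpM2l l20 key.
have : 0 <= lam ^+ 2 * w by rewrite mulr_ge0// ltW.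
by rewrite sE; nra.
Qed.
End exp_bounds.

(** * The Cramer transform *)

Section cramer.
Context (R : realType) (F : probability R R).

Lemma measurable_expR_affine (a b : R) :
  measurable_fun setT (fun x : R => expR (a * (x - b))).
Proof.
apply: measurableT_comp => //; apply: measurable_funM => //.
exact: measurable_funB.
Qed.

Lemma measurable_expR_linear (a : R) : measurable_fun setT (fun x : R => expR (a * x)).
Proof. by apply: measurableT_comp => //; exact: measurable_funM. Qed.

Lemma mgf_pos (l : R) : (mgf F l < +oo)%E ->
  exists2 m : R, 0 < m & mgf F l = m%:E.
Proof.
move=> mfin.
have m0 : (0 <= mgf F l)%E by apply: integral_ge0 => x _; rewrite lee_fin expR_ge0.
have mE : mgf F l = (fine (mgf F l))%:E by rewrite fineK// ge0_fin_numE.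
exists (fine (mgf F l)) => //.
rewrite lt0r fine_ge0// andbT; apply/negP => /eqP m00.
have : F setT = 0%E.
  apply: (measure_eq0_integral_gt0 measurableT (measurable_expR_linear l)).
    by move=> x _; exact: expR_gt0.
  by rewrite -/(mgf F l) mE m00.
by rewrite probability_setT => /eqP; rewrite onee_eq0.
Qed.

Lemma mgf0 : mgf F 0 = 1%E.
Proof.
rewrite /mgf; under eq_integral do rewrite mul0r expR0.
by rewrite (integral_cst1 (probability_setT F)).
Qed.

Lemma cramer_ge0 (x : R) : (0 <= cramer F x)%E.
Proof.
apply: ereal_sup_ubound; exists 0 => //.
by rewrite mul0r mgf0 lne1 sube0.
Qed.

Lemma expeN_ge0 (L : \bar R) : 0 <= expeN L.
Proof. by rewrite /expeN fine_ge0// expeR_ge0. Qed.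

Lemma expeN_lt1 (L : \bar R) : (0 < L)%E -> expeN L < 1.
Proof. by case: L => [l||]//= l0; rewrite /expeN/= ?expR_lt1 ?oppr_lt0. Qed.

(** Optimizing a family of exponential bounds also covers an infinite transform,
    where it forces p <= 0. *)
Lemma le_expeN_cramer (x p : R) (t : nat) : (0 < t)%N -> 
  (forall l m : R, 0 < m -> mgf F l = m%:E -> p <= (expR (- (l * x)) * m) ^+ t) ->
  p <= expeN (cramer F x) ^+ t.
Proof.
move=> t0 pl; have [p0|p0] := leP p 0.
  by rewrite (le_trans p0)// exprn_ge0// expeN_ge0.
have tR : 0 < t%:R :> R by rewrite ltr0n.
have : (cramer F x <= (- (ln p / t%:R))%:E)%E.
  apply: ge_ereal_sup => _ [l _ <-].
  have [mfin|] := ltP (mgf F l) +oo%E; last by rewrite leye_eq => /eqP ->; rewrite leNye.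
  have [m m0 mE] := mgf_pos mfin.
  rewrite mE lne_EFin// -EFinB lee_fin lerNr ler_pdivrMr//.
  have q0 : 0 < expR (- (l * x)) * m by rewrite mulr_gt0 ?expR_gt0.
  have := pl _ _ m0 mE; rewrite -ler_ln ?posrE ?exprn_gt0//.
  rewrite lnXn// lnM ?posrE ?expR_gt0// expRK => /le_trans; apply.
  by rewrite -[leLHS]mulr_natr ler_pM2r// opprB addrC.
have := cramer_ge0 x; case: (cramer F x) => [L||]//= _; rewrite lee_fin => Lp.
rewrite /expeN/= -expRM_natl -[leLHS]lnK ?posrE// ler_expR.
by rewrite mulrN lerNr -ler_pdivlMl// mulrC mulNr.
Qed.

Hypotheses (Fle1 : semibounded F) (mgfF : mgf_finite_near0 F).

Let mgf_finite : exists2 a : R, 0 < a &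
  exists m1 m2 : R, mgf F a = m1%:E /\ mgf F (- a) = m2%:E.
Proof.
have [eta eta0 fin] := mgfF; exists (eta / 2); first by rewrite divr_gt0.
have h : `|eta / 2| < eta by rewrite gtr0_norm ?divr_gt0//; lra.
have [m1 _ m1E] := mgf_pos (fin _ h).
rewrite -normrN in h.
by have [m2 _ m2E] := mgf_pos (fin _ h); exists m1, m2.
Qed.

Lemma integrable_expR (l m : R) : mgf F l = m%:E ->
  F.-integrable setT (fun x => (expR (l * x))%:E).
Proof.
move=> mE; apply/integrableP; split.
  by apply/measurable_EFinP; exact: measurable_expR_linear.
under eq_integral do rewrite gee0_abs ?lee_fin ?expR_ge0//.
by rewrite -/(mgf F l) mE ltry.
Qed.

Lemma integrable_mean : F.-integrable setT EFin.
Proof.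
have [a a0 [m1 [m2 [m1E m2E]]]] := mgf_finite.
have i1 := integrable_expR m1E; have i2 := integrable_expR m2E.
apply: (@le_integrable _ _ _ F _ measurableT EFin
  (fun x => a^-1%:E * ((expR (a * x))%:E + (expR (- a * x))%:E))%E) => //.
- move=> x _; rewrite -EFinD -EFinM /= lee_fin.
  rewrite [leRHS]ger0_norm; last by rewrite mulr_ge0 ?invr_ge0 ?ltW// addr_gt0 ?expR_gt0.
  rewrite ler_pdivlMl// -{1}(gtr0_norm a0) -normrM.
  have := expR_ge1Dx (a * x); have := expR_ge1Dx (- a * x).
  have := expR_gt0 (a * x); have := expR_gt0 (- a * x).
  by rewrite mulNr; case: (ger0P (a * x)) => _; lra.
- apply: (@integrableZl _ _ _ F setT measurableT a^-1
    (fun x => (expR (a * x))%:E + (expR (- a * x))%:E)%E).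
  exact: integrableD.
Qed.

Let mu := mean F.

Lemma Rintegral_mean : \int[F]_x x = mu. Proof. by []. Qed.

Lemma integral_expR_shift (l x m : R) : mgf F l = m%:E ->
  (\int[F]_y (expR (l * (y - x)))%:E = (expR (- (l * x)) * m)%:E)%E.
Proof.
move=> mE; under eq_integral do rewrite mulrBr addrC expRD EFinM.
rewrite ge0_integralZl//; last first.
  by apply/measurable_EFinP; exact: measurable_expR_linear.
by rewrite -/(mgf F l) mE EFinM.
Qed.

(** The exponential lies above its tangent at x.  In particular values of l of the
    wrong sign give trivial Chernoff bounds, so the supremum over all l is allowed. *)
Lemma tangent_le_mgf (l x m : R) : mgf F l = m%:E -> 1 + l * (mu - x) <= expR (- (l * x)) * m.
Proof.
move=> mE.
have iexp : F.-integrable setT (fun y => (expR (l * (y - x)))%:E).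
  apply/integrableP; split.
    by apply/measurable_EFinP; exact: measurable_expR_affine.
  under eq_integral do rewrite gee0_abs ?lee_fin ?expR_ge0//.
  by rewrite (integral_expR_shift x mE) ltry.
have iaff : F.-integrable setT (fun y => ((1 - l * x) + l * y)%:E).
  apply: (@integrableD _ _ _ F setT measurableT (cst (1 - l * x)%:E) (fun y => (l * y)%:E)).
    exact: finite_measure_integrable_cst.
  exact: (integrableZl measurableT l integrable_mean).
have : \int[F]_y ((1 - l * x) + l * y) <= \int[F]_y expR (l * (y - x)).
  apply: le_Rintegral => // y _.
  by apply: le_trans (expR_ge1Dx _); rewrite le_eqVlt; apply/orP; left; apply/eqP; ring.
rewrite [leRHS]/Rintegral (integral_expR_shift x mE)/=.
rewrite RintegralD//; last 2 first.
- exact: (finite_measure_integrable_cst F).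
- exact: (integrableZl measurableT l integrable_mean).
rewrite (Rintegral_cst1 (probability_setT F)) RintegralZl//; last exact: integrable_mean.
by rewrite Rintegral_mean => /(le_trans _); apply; rewrite le_eqVlt; apply/orP; left; apply/eqP; ring.
Qed.

(** To second order in th the moment generating function of a (X - x) at th is at most
    1 + th D + th ^ 2 C, which is less than 1 for small th of sign opposite to D. *)
Lemma cramer_gt0 (x : R) : x != mu -> (0 < cramer F x)%E.
Proof.
move=> xmu; have [a a0 [m1 [m2 [m1E m2E]]]] := mgf_finite.
pose C := expR (- (a * x)) * m1 + expR (- (- a * x)) * m2.
have C0 : 0 < C.
  have m10 : 0 < m1.
    have /mgf_pos[m m0 mE] : (mgf F a < +oo)%E by rewrite m1E ltry.
    by move: mE; rewrite m1E => -[->].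
  have m20 : 0 < m2.
    have /mgf_pos[m m0 mE] : (mgf F (- a) < +oo)%E by rewrite m2E ltry.
    by move: mE; rewrite m2E => -[->].
  by rewrite addr_gt0// mulr_gt0// expR_gt0.
pose D := a * (mu - x).
have D0 : D != 0 by apply: mulf_neq0; [rewrite gt_eqF|rewrite subr_eq0 eq_sym].
have nD0 : 0 < `|D| by rewrite normr_gt0.
pose th := - Num.sg D * Num.min 1 (`|D| / (2 * C)).
have min0 : 0 < Num.min 1 (`|D| / (2 * C)).
  by rewrite lt_min ltr01 divr_gt0// mulr_gt0.
set b := Num.min _ _ in th min0.
have b1 : b <= 1 by rewrite ge_min lexx.
have bD : b * (2 * C) <= `|D|.
  by rewrite -ler_pdivlMr ?mulr_gt0// ge_min lexx orbT.
have thD : th * D = - (b * `|D|) by rewrite /th mulNr mulNr mulrAC -normrEsg mulrC.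
have th2 : th ^+ 2 = b ^+ 2.
  by rewrite /th mulNr sqrrN exprMn sqr_sg D0 mul1r.
have th1 : `|th| <= 1.
  by rewrite /th normrM normrN normr_sg D0 mul1r gtr0_norm.
pose l := th * a.
have bound : (\int[F]_y (expR (l * (y - x)))%:E <=
    (1 + th * D + th ^+ 2 * C)%:E)%E.
  have i1 : F.-integrable setT (fun y => (expR (a * (y - x)))%:E).
    apply/integrableP; split.
      by apply/measurable_EFinP; exact: measurable_expR_affine.
    under eq_integral do rewrite gee0_abs ?lee_fin ?expR_ge0//.
    by rewrite (integral_expR_shift x m1E) ltry.
  have i2 : F.-integrable setT (fun y => (expR (- a * (y - x)))%:E).
    apply/integrableP; split.
      by apply/measurable_EFinP; exact: measurable_expR_affine.
    under eq_integral do rewrite gee0_abs ?lee_fin ?expR_ge0//.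
    by rewrite (integral_expR_shift x m2E) ltry.
  have i12 := integrableZl measurableT (th ^+ 2) (integrableD measurableT i1 i2).
  have i3 := integrableZl measurableT l integrable_mean.
  have i4 := finite_measure_integrable_cst F (1 - l * x) measurableT.
  have i34 := integrableD measurableT i4 i3.
  apply: (@le_trans _ _ (\int[F]_y (((cst (1 - l * x) y)%:E + l%:E * y%:E) +
     (th ^+ 2)%:E * ((expR (a * (y - x)))%:E + (expR (- a * (y - x)))%:E)))%E).
    apply: ge0_le_integral => //.
    - by apply/measurable_EFinP; exact: measurable_expR_affine.
    - exact: measurable_int (integrableD measurableT i34 i12).
    - move=> y _; rewrite -[leRHS]/((1 - l * x + l * y +
        th ^+ 2 * (expR (a * (y - x)) + expR (- a * (y - x))))%:E) lee_fin.
      have := expR_le_quadratic (a * (y - x)) th1.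
      rewrite mulrA -/l -mulNr => /le_trans; apply.
      by rewrite le_eqVlt; apply/orP; left; apply/eqP; rewrite /cst; ring.
  rewrite (integralD measurableT i34 i12) (integralD measurableT i4 i3).
  rewrite (integralZl measurableT (integrableD measurableT i1 i2)).
  rewrite (integralD measurableT i1 i2) (integral_expR_shift x m1E) (integral_expR_shift x m2E).
  rewrite (integralZl measurableT integrable_mean).
  rewrite (integral_cst1 (probability_setT F)).
  have -> : (\int[F]_y y%:E = mu%:E)%E.
    by rewrite /mu /mean fineK//; exact: integrable_fin_num integrable_mean.
  rewrite -[leLHS]/((1 - l * x + l * mu + th ^+ 2 * C)%:E) lee_fin.
  by rewrite le_eqVlt; apply/orP; left; apply/eqP; rewrite /l /D; ring.
have lt1 : 1 + th * D + th ^+ 2 * C < 1.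
  by rewrite thD th2; nra.
have mgfl : (mgf F l < +oo)%E.
  have -> : (mgf F l = (expR (l * x))%:E * \int[F]_y (expR (l * (y - x)))%:E)%E.
    rewrite -ge0_integralZl//.
      by apply: eq_integral => y _; rewrite -EFinM -expRD; congr (expR _)%:E; ring.
    by apply/measurable_EFinP; exact: measurable_expR_affine.
  have le := lee_wpmul2l (_ : 0 <= (expR (l * x))%:E)%E bound.
  by apply: le_lt_trans (le _) _; rewrite ?lee_fin ?expR_ge0// -EFinM ltry.
have [m m0 mE] := mgf_pos mgfl.
apply: (@lt_le_trans _ _ (l * x - ln m)%:E).
  rewrite lte_fin subr_gt0 -ltr_expR lnK ?posrE//.
  move: bound; rewrite (integral_expR_shift x mE) lee_fin => /le_lt_trans /(_ lt1).
  by rewrite expRN mulrC ltr_pdivrMr ?expR_gt0// mul1r.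
by apply: ereal_sup_ubound; exists l => //; rewrite mE lne_EFin// EFinB.
Qed.

End cramer.

Section chernoff.
Context d (T : measurableType d) (R : realType) (P : probability T R).
Variables (Y : nat -> {RV P >-> R}) (F : probability R R).
Hypotheses (iidY : iid_with_law Y F) (Fle1 : semibounded F).
Hypothesis mgfF : mgf_finite_near0 F.
Variables (x : R) (t : nat).
Hypothesis t0 : (0 < t)%N.

Local Notation avg w := (empmean (fun s => Y s w) t).

Lemma measurable_empmean : measurable_fun setT (fun w => avg w).
Proof.
apply: measurable_funM => //; apply: measurable_sum => s; exact: measurable_funPT.
Qed.

Let chernoff (A : set T) (sgn : bool) :
  measurable A -> (if sgn then mean F <= x else x <= mean F) ->
  (forall w, A w -> if sgn then x <= avg w else avg w <= x) ->
  fine (P A) <= expeN (cramer F x) ^+ t.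
Proof.
move=> mA xm Aw; apply: le_expeN_cramer => // l m m0 mE.
have PA1 : fine (P A) <= 1 by rewrite -lee_fin fineK ?fin_num_measure// probability_le1.
have [lx|lx] := leP 0 (l * (mean F - x)).
  apply: (le_trans PA1); rewrite exprn_ege1//.
  by apply: le_trans (tangent_le_mgf mgfF x mE); rewrite lerDl.
rewrite -lee_fin fineK ?fin_num_measure//.
apply: (chernoff_prod_iid iidY (g := fun y => expR (l * (y - x)))) => //.
- exact: measurable_expR_affine.
- by rewrite (integral_expR_shift x mE).
- move=> w /Aw aw; rewrite -expR_sum -expR0 ler_expR.
  rewrite -mulr_sumr sumrB sumr_const card_ord.
  have tR : 0 < t%:R :> R by rewrite ltr0n.
  have -> : \sum_(s < t) Y s w - x *+ t = t%:R * (avg w - x).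
    by rewrite /empmean -[x *+ t]mulr_natl; field; rewrite gt_eqF.
  rewrite mulrCA mulr_ge0// ?ler0n//.
  case: sgn xm aw {Aw} => xm aw.
    have l0 : 0 <= l by rewrite leNgt; apply/negP => l0; nra.
    by rewrite mulr_ge0// subr_ge0.
  have l0 : l <= 0 by rewrite leNgt; apply/negP => l0; nra.
  by rewrite mulr_le0// subr_le0.
Qed.

Lemma chernoff_lower : x <= mean F ->
  fine (P [set w | avg w <= x]) <= expeN (cramer F x) ^+ t.
Proof.
move=> xm; apply: (@chernoff _ false) => //.
have := measurable_fun_ler measurable_empmean (measurable_cst x) => /(_ measurableT [set true]).
rewrite setTI; exact.
Qed.

Lemma chernoff_upper : mean F <= x ->
  fine (P [set w | x <= avg w]) <= expeN (cramer F x) ^+ t.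
Proof.
move=> xm; apply: (@chernoff _ true) => //.
have := measurable_fun_ler (measurable_cst x) measurable_empmean => /(_ measurableT [set true]).
rewrite setTI; exact.
Qed.

End chernoff.

(** * Deviations of the empirical Dinf *)

Section deviations.
Context d (T : measurableType d) (R : realType) (P : probability T R).
Variables (Y : nat -> {RV P >-> R}) (F : probability R R).
Hypotheses (iidY : iid_with_law Y F) (Fle1 : semibounded F).
Hypothesis mgfF : mgf_finite_near0 F.

Let F1 : F setT = 1%E := probability_setT F.
Let iF : F.-integrable setT EFin := integrable_mean mgfF.

Section dinf_deviation.
Variables (M c0 eps delta : R).
Hypotheses (meanM : mean F <= M) (M1 : M < 1) (c0_ge : 2163 / 1000 <= c0).
Hypothesis delta0 : 0 < delta.
Let D := fine (Dinf F M).
Let xi := eps * D - delta / (1 - M).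
Hypothesis xi0 : 0 < xi.

Let c := c0 + (1 - mean F) / (1 - M).
(* The exponent that realizes the two cases of the rate tcramer. *)
Let lam := Num.min (xi / c) (1 / 2).

(** With the expectation of 1 / w at most 1 + lam / 20 and that of w at most
    (1 - mean F) / (1 - M), the second-order term is at most lam ^ 2 c / 2 with 2.15 in
    place of c0.  The gap with 2.163 absorbs the slack lam / 20 left by the
    approximate duality. *)
Let mgf_log_wealth nu : 0 <= nu -> nu * (1 - M) < 1 ->
  \int[F]_y (wealth M nu y)^-1 <= 1 + lam / 20 ->
  D <= \int[F]_y ln (wealth M nu y) + lam / 20 ->
  (\int[F]_y (expR (- lam * ln (wealth M nu y) + lam * (D - xi)))%:E <=
    (expR (- tcramer c0 xi (mean F) M))%:E)%E.
Proof.
move=> nu0 nu1 g1 Dh.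
have M0 : 0 < 1 - M by rewrite subr_gt0.
have m1 : 0 <= 1 - mean F by rewrite subr_ge0 (le_trans meanM)// ltW.
have c00 : 0 < c0 by have := c0_ge; lra.
have c_gt0 : 0 < c by rewrite /c ltr_pwDl// divr_ge0// ltW.
have lam0 : 0 < lam by rewrite lt_min !divr_gt0.
have lam2 : lam <= 1 / 2 by rewrite ge_min lexx orbT.
set w := wealth M nu; set b := lam * (D - xi).
have w0 y : 0 < w y by exact: wealth_gt0.
set g := \int[F]_y (w y)^-1 in g1; set h := \int[F]_y ln (w y) in Dh.
have iw : F.-integrable setT (EFin \o w) by exact: integrable_wealth.
have iVw : F.-integrable setT (EFin \o (fun y => (w y)^-1)).
  exact: integrable_inv_wealth.
have iln : F.-integrable setT (EFin \o (fun y => ln (w y))).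
  exact: integrable_ln_wealth.
have i1 : F.-integrable setT (EFin \o (fun y => 1 + - lam * ln (w y))).
  exact: (integrableD measurableT (finite_measure_integrable_cst F 1 measurableT)
    (integrableZl measurableT (- lam) iln)).
have i2 : F.-integrable setT (EFin \o (fun y => lam ^+ 2 * (w y)^-1)).
  exact: (integrableZl measurableT (lam ^+ 2) iVw).
have i3 : F.-integrable setT (EFin \o (fun y => lam ^+ 2 / 2 * w y)).
  exact: (integrableZl measurableT (lam ^+ 2 / 2) iw).
have i23 : F.-integrable setT
    (EFin \o (fun y => lam ^+ 2 * (w y)^-1 + lam ^+ 2 / 2 * w y)).
  exact: (integrableD measurableT i2 i3).
have i123 : F.-integrable setT (EFin \o (fun y => (1 + - lam * ln (w y)) +
    (lam ^+ 2 * (w y)^-1 + lam ^+ 2 / 2 * w y))).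
  exact: (integrableD measurableT i1 i23).
pose bound y := (1 + - lam * ln (w y)) + (lam ^+ 2 * (w y)^-1 + lam ^+ 2 / 2 * w y).
have boundE : \int[F]_y bound y =
    1 - lam * h + (lam ^+ 2 * g + lam ^+ 2 / 2 * (1 - nu * (mean F - M))).
  rewrite /bound RintegralD// RintegralD//; last 2 first.
  - exact: (finite_measure_integrable_cst F 1 measurableT).
  - exact: (integrableZl measurableT (- lam) iln).
  rewrite RintegralD// !RintegralZl// (Rintegral_cst1 F1) mulNr.
  by rewrite (Rintegral_wealth F1 Fle1 iF).
have le_bound : (\int[F]_y (expR (- lam * ln (w y) + b))%:E <=
    (expR b * \int[F]_y bound y)%:E)%E.
  have ib := integrableZl measurableT (expR b) i123.
  have -> : (expR b * \int[F]_y bound y)%:E = (\int[F]_y (expR b * bound y)%:E)%E.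
    rewrite -RintegralZl// /Rintegral fineK//; exact: integrable_fin_num ib.
  apply: le_integral_measurable.
  - apply/measurable_EFinP; apply: measurableT_comp => //.
    apply: measurable_funD => //; apply: measurable_funM => //.
    by apply: measurableT_comp; [exact: measurable_ln|exact: measurable_wealth].
  - exact: measurable_int ib.
  - move=> y; rewrite lee_fin addrC expRD ler_wpM2l ?expR_ge0//.
    have lam12 : 0 < lam <= 1 / 2 by rewrite lam0.
    apply: le_trans (expRN_ln_le lam12 (w0 y)) _.
    by rewrite le_eqVlt; apply/orP; left; apply/eqP; rewrite /bound; field; rewrite gt_eqF.
apply: le_trans le_bound _; rewrite lee_fin boundE.
set ew := 1 - nu * (mean F - M).
have ew_le : ew <= (1 - mean F) / (1 - M).
  rewrite ler_pdivlMr// /ew.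
  have := ler_wpM2r (_ : 0 <= M - mean F) (ltW nu1).
  by rewrite subr_ge0 => /(_ meanM); lra.
have exp_le : 1 - lam * h + (lam ^+ 2 * g + lam ^+ 2 / 2 * ew) <=
    expR (- lam * h + (lam ^+ 2 * g + lam ^+ 2 / 2 * ew)).
  by apply: le_trans (expR_ge1Dx _); rewrite mulNr -[leLHS]addrA lexx.
apply: le_trans (ler_wpM2l (expR_ge0 b) exp_le) _.
rewrite -expRD ler_expR.
have l2 : 0 <= lam ^+ 2 by exact: sqr_ge0.
have gl := ler_wpM2l l2 g1.
have el := ler_wpM2l l2 ew_le.
have hl := ler_wpM2l (ltW lam0) Dh.
have l3 : lam ^+ 2 * lam <= lam ^+ 2 * (1 / 2) by rewrite ler_wpM2l.
have cl : lam ^+ 2 * (2163 / 1000) <= lam ^+ 2 * c0 by rewrite ler_wpM2l.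
apply: (@le_trans _ _ (- lam * xi + lam ^+ 2 / 2 * c)).
  rewrite /c /b; set q := (1 - mean F) / (1 - M) in el *; lra.
rewrite /tcramer -/c; case: ifPn => [xic|].
  have -> : lam = xi / c.
    by apply/min_idPl; rewrite ler_pdivrMr//; lra.
  by rewrite le_eqVlt; apply/orP; left; apply/eqP; field; rewrite gt_eqF.
rewrite -ltNge => xic.
have -> : lam = 1 / 2.
  by apply/min_idPr; rewrite ler_pdivlMr//; lra.
lra.
Qed.

(** Weak duality reduces the event to a deviation of the average logarithmic wealth,
    for one stake that is nearly optimal for F.  Playing the game that is fair for
    M instead of M - delta costs at most ln (1 + nu delta) <= delta / (1 - M). *)
Lemma Dinf_deviation : exists A : nat -> set T, [/\ forall t, measurable (A t),
  forall t w, (0 < t)%N ->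
    (Dinf (empirical (fun s => Y s w) t) (M - delta) < ((1 - eps) * D)%:E)%E ->
    A t w &
  forall t, (P (A t) <= (expR (- tcramer c0 xi (mean F) M) ^+ t)%:E)%E].
Proof.
have M0 : 0 < 1 - M by rewrite subr_gt0.
have delta_gt0 := delta0.
have xi_gt0 := xi0.
have c_gt0 : 0 < c.
  have c00 : 0 < c0 by have := c0_ge; lra.
  have m1 : 0 <= 1 - mean F by rewrite subr_ge0 (le_trans meanM)// ltW.
  by rewrite /c ltr_pwDl// divr_ge0// ltW.
have lam0 : 0 < lam by rewrite lt_min !divr_gt0.
have eta0 : 0 < lam / 20 by lra.
have [nu [nu0 nu1 g1 Dle]] := Dinf_duality F1 Fle1 iF M1 eta0.
have D0 : D != 0.
  apply/eqP => D0; move: xi0; rewrite /xi D0 mulr0 sub0r oppr_gt0.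
  by rewrite ltNge divr_ge0// ltW.
have Dh : D <= \int[F]_y ln (wealth M nu y) + lam / 20.
  rewrite -lee_fin; apply: le_trans Dle; rewrite /D.
  by move: D0; rewrite /D; case: (Dinf F M) => //=; rewrite eqxx.
have mlnw : measurable_fun setT (fun y => ln (wealth M nu y)).
  by apply: measurableT_comp; [exact: measurable_ln|exact: measurable_wealth].
pose A t := [set w | \sum_(s < t) ln (wealth M nu (Y s w)) <= t%:R * (D - xi)].
have mA t : measurable (A t).
  have mf : measurable_fun setT (fun w => \sum_(s < t) ln (wealth M nu (Y s w))).
    by apply: measurable_sum => s; apply: (measurableT_comp mlnw).
  have := measurable_fun_ler mf (measurable_cst (t%:R * (D - xi))) =>
    /(_ measurableT [set true]).
  rewrite setTI; exact.
exists A; split => // [t w t0 Dlt|t].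
  have m_mu : M - delta <= M by lra.
  have := le_lt_trans (Dinf_empirical_ge _ t0 nu0 nu1 m_mu) Dlt.
  rewrite lte_fin (_ : M - (M - delta) = delta); last by ring.
  have tR : 0 < t%:R :> R by rewrite ltr0n.
  rewrite /A /= -ler_pdivrMl// => lt.
  have lnle : ln (1 + nu * delta) <= delta / (1 - M).
    apply: (@le_trans _ _ (nu * delta)).
      apply: le_ln1Dx; apply: (@lt_le_trans _ _ 0); first by lra.
      by rewrite mulr_ge0// ltW.
    by rewrite mulrC ler_wpM2l ?(ltW delta0)// -[leRHS]mul1r ler_pdivlMr// ltW.
  by rewrite /xi; lra.
apply: (chernoff_prod_iid iidY
  (g := fun y => expR (- lam * ln (wealth M nu y) + lam * (D - xi)))) => //.
- by apply: measurableT_comp => //; apply: measurable_funD => //; exact: measurable_funM.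
- exact: mgf_log_wealth.
- move=> w /= Aw; rewrite -expR_sum -expR0 ler_expR big_split/= -mulr_sumr.
  rewrite sumr_const card_ord -[_ *+ t]mulr_natl mulrCA mulNr addrC -mulrBr.
  by apply: mulr_ge0; [exact: ltW|rewrite subr_ge0].
Qed.

End dinf_deviation.

Section grid_deviation.
Variables (x r : R) (t : nat).
Hypotheses (xmean : x <= mean F) (x1 : x < 1) (r01 : 0 < r < 1) (t0 : (0 < t)%N).
Local Notation S w := (grid_wealth (fun s => Y s w) t x).
Local Notation U := [set w | empmean (fun s => Y s w) t <= x].

Lemma measurable_grid_wealth : measurable_fun setT (fun w => S w).
Proof.
apply: measurable_funM => //; apply: measurable_sum => j.
apply: measurable_prod => s _.
exact: (measurableT_comp (measurable_wealth _ _)).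
Qed.

Lemma measurable_empmean_le : measurable U.
Proof.
have := measurable_fun_ler (measurable_empmean Y t) (measurable_cst x) =>
  /(_ measurableT [set true]).
rewrite setTI; exact.
Qed.

(** A game that is fair for mean x is unfavourable when the mean is larger. *)
Lemma expectation_grid_wealth : (\int[P]_w (S w)%:E <= (expR 1 * t.+2%:R)%:E)%E.
Proof.
pose a (j : 'I_t.+2) := 1 - grid_point t x j * (mean F - x).
have x0 : 0 < 1 - x by rewrite subr_gt0.
have gp0 (j : 'I_t.+2) : 0 <= grid_point t x j.
  by apply: divr_ge0; [exact: divr_ge0|exact: ltW].
have wE (j : 'I_t.+2) : (\int[F]_y (wealth x (grid_point t x j) y)%:E = (a j)%:E)%E.
  have iw := integrable_wealth iF x (grid_point t x j).
  rewrite /a -[mean F]/(\int[F]_y y) -(Rintegral_wealth F1 Fle1 iF).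
  rewrite /Rintegral fineK//.
  exact: integrable_fin_num iw.
have prodE (j : 'I_t.+2) :
    (\int[P]_w (\prod_(s < t) wealth x (grid_point t x j) (Y s w))%:E <= 1)%E.
  rewrite (integral_prod_iid iidY t (fun=> measurable_wealth _ _) _ (fun=> wE j)).
    rewrite lee_fin prodr_const card_ord exprn_ile1//.
      rewrite -lee_fin -wE; apply: integral_ge0 => y _.
      by rewrite lee_fin wealth_grid_ge0.
    by rewrite /a gerBl mulr_ge0// subr_ge0.
  by move=> _ y; exact: wealth_grid_ge0.
have S0 (j : 'I_t.+2) w :
    (0 <= (\prod_(s < t) wealth x (grid_point t x j) (Y s w))%:E)%E.
  by rewrite lee_fin prodr_ge0// => s _; exact: wealth_grid_ge0.
have mS (j : 'I_t.+2) : measurable_fun setT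
    (fun w => (\prod_(s < t) wealth x (grid_point t x j) (Y s w))%:E).
  apply/measurable_EFinP; apply: measurable_prod => s _.
  exact: (measurableT_comp (measurable_wealth _ _)).
under eq_integral do rewrite /grid_wealth EFinM -sumEFin.
rewrite ge0_integralZl//; last 2 first.
- exact: emeasurable_sum.
- by move=> w _; apply: sume_ge0.
rewrite EFinM; apply: lee_wpmul2l; first by rewrite lee_fin expR_ge0.
rewrite ge0_integral_sum//.
apply: (@le_trans _ _ (\sum_(j < t.+2) 1)%E); first exact: lee_sum.
by rewrite sumEFin sumr_const card_ord.
Qed.

(** Weighted arithmetic-geometric mean inequality for z and expR L. *)
Let young (z L : R) : 1 <= z -> z `^ (1 - r) <=
  expR (- (r * L)) * ((1 - r) * z + r * expR L).
Proof.
move=> z1; have z0 : 0 < z by lra.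
case/andP: r01 => r0 r1.
rewrite expRN mulrC ler_pdivlMr ?expR_gt0// /powR gt_eqF// -expRD.
set m := _ + _.
have ez := ler_wpM2l (expR_ge0 m) (expR_ge1Dx (ln z - m)).
have eL := ler_wpM2l (expR_ge0 m) (expR_ge1Dx (L - m)).
rewrite -!expRD [m + (_ - _)]addrC subrK lnK ?posrE// in ez.
rewrite -!expRD [m + (_ - _)]addrC subrK in eL.
have r1' : 0 <= 1 - r by lra.
have := ler_wpM2l r1' ez; have := ler_wpM2l (ltW r0) eL.
have mE : m = (1 - r) * ln z + r * L by [].
have : expR m = (1 - r) * (expR m * (1 + (ln z - m))) + r * (expR m * (1 + (L - m))).
  by rewrite mE; ring.
lra.
Qed.

(** Interpolation between the expectation of the grid wealth, at most e (t + 2), and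
    the probability that the empirical mean is at most x, at most expR (- t L) where
    L is the Cramer transform. *)
Lemma expectation_grid_powR :
  (\int[P]_w (\1_U w * S w `^ (1 - r))%:E <=
    (2 * expR 1 * t.+1%:R * expeN (r%:E * cramer F x) ^+ t)%:E)%E.
Proof.
have mU := measurable_empmean_le.
have mS := measurable_grid_wealth.
have mpow : measurable_fun setT (fun w => S w `^ (1 - r)).
  exact: (measurableT_comp (measurable_powR (1 - r)) mS).
have m1U : measurable_fun setT (\1_U : T -> R) by exact: measurable_indic.
have PU := chernoff_lower iidY mgfF t0 xmean.
have r0 : 0 < r by case/andP: r01.
have r1 : r < 1 by case/andP: r01.
have := cramer_ge0 F x; move: PU; case: (cramer F x) => [L| |]//.
- rewrite /expeN /= -expRM_natl => PU L0.
  have -> : (2 * expR 1 * t.+1%:R * expR (- (r * L)) ^+ t) =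
      expR (- (r * (t%:R * L))) * (2 * expR 1 * t.+1%:R).
    by rewrite -expRM_natl mulrC; congr (expR _ * _); ring.
  set q := expR (- (r * (t%:R * L))).
  have q0 : 0 <= q by exact: expR_ge0.
  pose k := q * (1 - r); pose l := q * (r * expR (t%:R * L)).
  have k0 : 0 <= k by rewrite mulr_ge0// subr_ge0 ltW.
  have l0 : 0 <= l by rewrite !mulr_ge0 ?expR_ge0// ltW.
  apply: (@le_trans _ _ (\int[P]_w (k%:E * (S w)%:E + l%:E * (\1_U w)%:E))%E).
    apply: le_integral_measurable.
    - by apply/measurable_EFinP; exact: measurable_funM.
    - apply: emeasurable_funD; apply/measurable_EFinP; exact: measurable_funM.
    - move=> w; rewrite -!EFinM -EFinD lee_fin.
      have S1 : 1 <= S w by exact: grid_wealth_ge1.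
      rewrite indicE; case: (w \in U).
        rewrite mul1r mulr1; apply: le_trans (young (t%:R * L) S1) _.
        by rewrite -/q /k /l mulrDr !mulrA lexx.
      by rewrite mulr0n mul0r mulr0 addr0 mulr_ge0// (le_trans ler01).
  rewrite ge0_integralD//; last 4 first.
  - by move=> w _; rewrite -EFinM lee_fin mulr_ge0// (le_trans ler01)// grid_wealth_ge1.
  - by apply/measurable_EFinP; exact: measurable_funM.
  - by move=> w _; rewrite -EFinM lee_fin mulr_ge0.
  - by apply/measurable_EFinP; exact: measurable_funM.
  rewrite !ge0_integralZl//; last 3 first.
  - exact/measurable_EFinP.
  - exact/measurable_EFinP.
  - by move=> w _; rewrite lee_fin (le_trans ler01)// grid_wealth_ge1.
  rewrite integral_indic// setIT.
  apply: (@le_trans _ _ ((k * (expR 1 * t.+2%:R))%:E +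
      (l * expR (t%:R * - L))%:E)%E).
    apply: leeD; rewrite [leRHS]EFinM; apply: lee_wpmul2l; rewrite ?lee_fin//.
      exact: expectation_grid_wealth.
    by move: PU; rewrite -lee_fin fineK//; exact: fin_num_measure.
  rewrite -EFinD lee_fin /k /l -!mulrA -mulrDr ler_wpM2l//.
  rewrite -expRD mulrN addrN expR0 mulr1.
  have e1 : 1 <= expR 1 :> R by rewrite -expR0 ler_expR.
  have tR : 0 <= t%:R :> R by [].
  have -> : t.+2%:R = t%:R + 2 :> R by rewrite -addn2 natrD.
  rewrite -natr1; set e := expR 1 in e1 *.
  have : 1 <= e * (t%:R + 2) by nra.
  have : e * (t%:R + 2) <= 2 * (e * (t%:R + 1)) by nra.
  nra.
- move=> PU _.
  have PU0 : P U = 0%E.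
    apply/eqP; rewrite eq_le measure_ge0 andbT.
    move: PU; rewrite /expeN/= expr0n gtn_eqF// -lee_fin fineK//.
    exact: fin_num_measure.
  have -> : (\int[P]_w (\1_U w * S w `^ (1 - r))%:E = \int[P]_w cst 0 w)%E.
    apply: ae_eq_integral => //.
    - by apply/measurable_EFinP; exact: measurable_funM.
    - exists U; split => // w /= h; apply: contrapT => nU; apply: h => _.
      by rewrite indicE memNset// mul0r.
  by rewrite integral0 lee_fin mulr_ge0// ?exprn_ge0 ?expeN_ge0// !mulr_ge0 ?expR_ge0.
Qed.
End grid_deviation.

End deviations.

(** * Expectation of the number of pulls *)

Section expectation_bounds.
Context d (T : measurableType d) (R : realType) (P : probability T R).
Implicit Types (f g : T -> R) (b c : R) (A : set T).

(** Closed under sums, which makes the expectation of a long sum routine. *)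
Definition expectation_le f b := [/\ measurable_fun setT f,
  forall w, 0 <= f w & (\int[P]_w (f w)%:E <= b%:E)%E].

Lemma expectation_le_cst c : 0 <= c -> expectation_le (fun=> c) c.
Proof. by move=> c0; split => //; rewrite (integral_cst1 (probability_setT P)). Qed.

Lemma expectation_le_indic A b : measurable A -> (P A <= b%:E)%E ->
  expectation_le \1_A b.
Proof.
by move=> mA PA; split => //; rewrite integral_indic// setIT.
Qed.

Lemma expectation_leD f g b c : expectation_le f b -> expectation_le g c ->
  expectation_le (fun w => f w + g w) (b + c).
Proof.
move=> [mf f0 fb] [mg g0 gc]; split.
- exact: measurable_funD.
- by move=> w; rewrite addr_ge0.
- under eq_integral do rewrite EFinD.
  rewrite ge0_integralD//; last 4 first.
  + by move=> w _; rewrite lee_fin.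
  + exact/measurable_EFinP.
  + by move=> w _; rewrite lee_fin.
  + exact/measurable_EFinP.
  by rewrite EFinD leeD.
Qed.

Lemma expectation_le_sum (I : Type) (s : seq I) (f : I -> T -> R) (b : I -> R) :
  (forall i, expectation_le (f i) (b i)) ->
  expectation_le (fun w => \sum_(i <- s) f i w) (\sum_(i <- s) b i).
Proof.
move=> fb; elim: s => [|i s IH].
  rewrite big_nil; under [X in expectation_le X]funext do rewrite big_nil.
  exact: expectation_le_cst.
rewrite big_cons; under [X in expectation_le X]funext do rewrite big_cons.
exact: expectation_leD.
Qed.

Lemma expectation_leZ c f b : 0 <= c -> expectation_le f b ->
  expectation_le (fun w => c * f w) (c * b).
Proof.
move=> c0 [mf f0 fb]; split.
- exact: measurable_funM.
- by move=> w; rewrite mulr_ge0.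
- under eq_integral do rewrite EFinM.
  rewrite ge0_integralZl//; last 2 first.
  + exact/measurable_EFinP.
  + by move=> w _; rewrite lee_fin.
  by rewrite EFinM lee_wpmul2l// lee_fin.
Qed.

(** For a function f such as the number of pulls, whose measurability is not
    established.  Its integral is the supremum over the simple functions below it, so
    f can be compared with the measurable function equal to g outside a null set N and
    to +oo on N. *)
Lemma integral_le_ae (f g : T -> R) b (Q : T -> Prop) :
  (forall w, 0 <= f w) -> {ae P, forall w, Q w} ->
  (forall w, Q w -> f w <= g w) -> expectation_le g b ->
  (\int[P]_w (f w)%:E <= b%:E)%E.
Proof.
move=> f0 [N [mN N0 QN]] fg [mg g0 gb].
pose h w := ((g w)%:E + +oo * (\1_N w)%:E)%E.
have hN w : w \in N -> h w = +oo%E.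
  by move=> wN; rewrite /h indicE wN mule1 addey.
have hnN w : w \notin N -> h w = (g w)%:E.
  by move=> wN; rewrite /h indicE (negbTE wN) mule0 adde0.
have fh w : ((f w)%:E <= h w)%E.
  case: (boolP (w \in N)) => wN; first by rewrite hN// leey.
  rewrite hnN// lee_fin fg//; apply: contrapT => nQ.
  by move/negP: wN; apply; rewrite inE; exact: QN.
have h0 w : (0 <= h w)%E by rewrite (le_trans _ (fh w))// lee_fin.
have mh : measurable_fun setT h.
  apply: emeasurable_funD; first exact/measurable_EFinP.
  by apply: emeasurable_funM => //; exact/measurable_EFinP/measurable_indic.
apply: le_trans gb.
have -> : (\int[P]_w (g w)%:E = \int[P]_w h w)%E.
  apply: ae_eq_integral => //; first exact/measurable_EFinP.
  exists N; split => // w /= nh; apply: contrapT => wN; apply: nh => _.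
  by rewrite hnN// notin_setE.
rewrite !ge0_integralTE//.
by apply: ereal_sup_le => _ [k kf <-]; exists k => // w; exact: le_trans (kf w) (fh w).
Qed.

End expectation_bounds.

Section geometric_sums.
Context (R : realType).
Implicit Types q : R.

Lemma geometric_sum_le q n : 0 <= q < 1 ->
  \sum_(t < n) q ^+ t.+1 <= (1 - q)^-1 - 1.
Proof.
move=> /andP[q0 q1]; have q1' : 0 < 1 - q by rewrite subr_gt0.
rewrite lerBrDr -[leRHS]mul1r ler_pdivlMr//.
suff -> : (\sum_(t < n) q ^+ t.+1 + 1) * (1 - q) = 1 - q ^+ n.+1.
  by rewrite gerBl exprn_ge0.
elim: n => [|n IH]; first by rewrite big_ord0 add0r mul1r expr1.
by rewrite big_ord_recr/= addrAC mulrDl IH (exprS q n.+1); ring.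
Qed.

Lemma geometric_deriv_sum_le q n : 0 <= q < 1 ->
  \sum_(t < n) t.+2%:R * q ^+ t.+1 <= ((1 - q) ^+ 2)^-1.
Proof.
move=> /andP[q0 q1]; have q1' : 0 < 1 - q by rewrite subr_gt0.
rewrite -[leRHS]mul1r ler_pdivlMr ?exprn_gt0//.
have -> : (\sum_(t < n) t.+2%:R * q ^+ t.+1) * (1 - q) ^+ 2 =
    1 - (1 - q) ^+ 2 - q ^+ n.+1 * (n%:R * (1 - q) + 2 - q).
  elim: n => [|n IH]; first by rewrite big_ord0 mul0r; ring.
  by rewrite big_ord_recr/= mulrDl IH -!natr1 (exprS q n.+1); ring.
have := sqr_ge0 (1 - q).
have : 0 <= q ^+ n.+1 * (n%:R * (1 - q) + 2 - q).
  rewrite mulr_ge0 ?exprn_ge0// -addrA addr_ge0 ?mulr_ge0 ?ler0n ?ltW//.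
  lra.
lra.
Qed.

End geometric_sums.

Lemma expeN_mul_lt1 (R : realType) (r : R) (L : \bar R) : 0 < r -> (0 < L)%E ->
  0 <= expeN L < 1 /\ 0 <= expeN (r%:E * L)%E < 1.
Proof.
move=> r0 L0; split; rewrite expeN_ge0 expeN_lt1//.
by rewrite mule_gt0// lte_fin.
Qed.

Lemma semibounded_rewards d (T : measurableType d) (R : realType)
    (P : probability T R) (Y : nat -> {RV P >-> R}) (F : probability R R) :
  iid_with_law Y F -> semibounded F -> {ae P, forall w, forall s, Y s w <= 1}.
Proof.
move=> [_ law] F1; apply: ae_foralln => s.
have mY : measurable (Y s @^-1` (`]-oo, 1%R]%classic : set R)).
  by rewrite -[_ @^-1` _]setTI; exact: measurable_funPT.
exists (~` (Y s @^-1` (`]-oo, 1%R]%classic : set R))); split.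
- exact: measurableC.
- apply: etrans (probability_setC P mY) _.
  have -> : P (Y s @^-1` (`]-oo, 1%R]%classic : set R)) = 1%E.
    exact: etrans (law s _ (measurable_itv _)) F1.
  by rewrite subee.
- by move=> w /= nle; rewrite in_itv/=.
Qed.

Theorem theorem4 (R : realType) (d : measure_display) (T : measurableType d)
    (P : probability T R) (K : nat)
    (F : 'I_K -> probability R R)
    (X : 'I_K -> nat -> {RV P >-> R})
    (c0 r eps delta : R) (i : 'I_K) :
  let mu := fun k => mean (F k) in
  let ms := mustar mu in
  let mp := muprime mu in
  let D := fine (Dinf (F i) ms) in
  let xi := eps * D - delta / (1 - ms) in
  let C : \bar R :=
    ((1 / (1 - expR (- tcramer c0 xi (mu i) ms)) +
      \sum_(k in Iopt mu) K%:R / (1 - expeN (cramer (F k) (ms - delta))) +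
      \sum_(k | k \notin Iopt mu)
         K%:R / (1 - expeN (cramer (F k) (mp + delta))))%:E +
     \big[mine/+oo]_(k in Iopt mu)
       (2 * (1 + K%:R) / (1 - expeN (cramer (F k) (mp + delta))) +
        2 * expR 1 /
          (r * (1 - expeN (r%:E * cramer (F k) (mp + delta))%E) ^+ 2))%:E)%E in
  (forall k, semibounded (F k)) ->
  (forall k, mgf_finite_near0 (F k)) ->
  (forall k, iid_with_law (X k) (F k)) ->
  2163 / 1000 <= c0 ->
  ms < 1 ->
  0 < r < 1 ->
  0 < eps < 1 ->
  i \notin Iopt mu ->
  0 < delta < ms - mp ->
  0 < xi ->
  forall n : nat, (0 < n)%N ->
  ('E_P[fun w => (dmed_pulls r (fun k s => X k s w) n i)%:R] <=
    (ln n%:R / ((1 - eps) * (1 - r) * D))%:E + C)%E.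
Proof.
move=> mu ms mp D xi C Fle1 mgfF iidX c0_ge ms1 r01 eps01 iopt delta_lt xi0 n n0.
case/andP: delta_lt => delta0 delta1; case/andP: r01 => r0 r1; case/andP: eps01 => eps0 eps1.
have [kopt _ [msE ms_max]] := @maxin_witness R K [set: 'I_K]%SET mu i (finset.in_setT _).
have ioptC : i \in (~: Iopt mu)%SET by rewrite finset.in_setC.
have [kalt _ [mpE mp_max]] := @maxin_witness R K (~: Iopt mu)%SET mu i ioptC.
rewrite -/(mustar mu) -/ms in msE; rewrite -/(muprime mu) -/mp in mpE.
have mu_le k : mu k <= ms by rewrite msE ms_max// finset.in_setT.
have mu_opt k : k \in Iopt mu -> mu k = ms by rewrite inE => /eqP.
have mu_alt k : k \notin Iopt mu -> mu k <= mp.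
  by move=> kA; rewrite mpE mp_max// finset.in_setC.
have lo1 : ms - delta < 1 by lra.
have hi1 : mp + delta < 1 by lra.
have D0 : 0 < D.
  have : 0 < eps * D.
    have : 0 < delta / (1 - ms) by rewrite divr_gt0// subr_gt0.
    by move: xi0; rewrite /xi; lra.
  by rewrite pmulr_rgt0.
pose d0 := (1 - eps) * D.
have d00 : 0 < d0 by rewrite mulr_gt0// subr_gt0.
pose a := expR (- tcramer c0 xi (mu i) ms).
have a01 : 0 <= a < 1.
  rewrite expR_ge0 expR_lt1 oppr_lt0 /tcramer.
  set c := c0 + _; have cgt0 : 0 < c.
    have c00 : 0 < c0 by lra.
    rewrite /c ltr_pwDl// divr_ge0// subr_ge0; last exact: ltW.
    by rewrite (le_trans (mu_le i))// ltW.
  case: ifPn => [_|]; first by rewrite divr_gt0 ?exprn_gt0// mulr_gt0.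
  by rewrite -ltNge; lra.
pose th k := if k \in Iopt mu then ms - delta else mp + delta.
pose q k := expeN (cramer (F k) (th k)).
have q01 k : 0 <= q k < 1.
  rewrite expeN_ge0 expeN_lt1// cramer_gt0// /th -/(mu k).
  case: ifPn => kopt'; first by rewrite (mu_opt _ kopt') lt_eqF//; lra.
  by have := mu_alt _ kopt' => ?; rewrite gt_eqF//; lra.
have [A [mA Aclose PA]] := Dinf_deviation (iidX i) (Fle1 i) (mgfF i) (mu_le i) ms1 c0_ge
  delta0 xi0.
set thr := ln n%:R / ((1 - eps) * (1 - r) * D).
set b1 := 1 / _ + _ + _ in C *.
rewrite /C addeA -EFinD -leeBlDl//.
(* The bound is proved for each optimal arm k0, then minimized. *)
apply: le_bigmin; first by rewrite leey.
move=> k0 k0opt; rewrite leeBlDl// -EFinD.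
set x := mp + delta.
pose q0 := expeN (cramer (F k0) x); pose qr := expeN (r%:E * cramer (F k0) x)%E.
have x_mean : x <= mean (F k0) by rewrite -/(mu k0) (mu_opt _ k0opt) /x; lra.
have [q001 qr01] : 0 <= q0 < 1 /\ 0 <= qr < 1.
  apply: expeN_mul_lt1 => //; apply: cramer_gt0 => //.
  by rewrite lt_eqF// -/(mu k0) (mu_opt _ k0opt) /x; lra.
(* Each t counts twice per misleading arm, whereas the claimed constant has a
   factor K. *)
have K2 : 2 <= K%:R :> R.
  have ik0 : i != k0 by apply: contraNneq iopt => ->.
  by rewrite ler_nat -(card_ord K); apply/card_gt1P; exists i, k0; split.
rewrite unlock.
pose U k t := [set w | if k \in Iopt mu
  then empmean (fun s => X k s w) t <= ms - delta
  else mp + delta <= empmean (fun s => X k s w) t].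
pose U0 t := [set w | empmean (fun s => X k0 s w) t <= x].
pose S t w := grid_wealth (fun s => X k0 s w) t x.
have mU k t : measurable (U k t).
  have mavg := measurable_empmean (X k) t.
  rewrite /U; case: (k \in Iopt mu).
    exact: (measurable_empmean_le (X k) (ms - delta) t).
  have := measurable_fun_ler (measurable_cst (mp + delta)) mavg =>
    /(_ measurableT [set true]).
  rewrite setTI; exact.
have PU k t : (P (U k t.+1) <= (q k ^+ t.+1)%:E)%E.
  rewrite -[P _]fineK ?fin_num_measure// lee_fin /U /q /th.
  case: (boolP (k \in Iopt mu)) => kA.
    by apply: (chernoff_lower (iidX k)) => //; rewrite -/(mu k) (mu_opt _ kA); lra.
  by apply: (chernoff_upper (iidX k)) => //; have := mu_alt _ kA; rewrite -/(mu k); lra.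
have mU0 t : measurable (U0 t) by exact: (measurable_empmean_le (X k0) x t).
have PU0 t : (P (U0 t.+1) <= (q0 ^+ t.+1)%:E)%E.
  rewrite -[P _]fineK ?fin_num_measure// lee_fin.
  exact: (chernoff_lower (iidX k0)).
have thr0 : 0 <= thr.
  by rewrite divr_ge0 ?ln_ge0 ?ler1n// !mulr_ge0// ?subr_ge0 ltW.
pose g w : R := 2 + thr + \sum_(t < n) \1_(A t.+1) w +
  \sum_k \sum_(t < n) 2 * \1_(U k t.+1) w +
  \sum_(t < n) (2 * \1_(U0 t.+1) w + \1_(U0 t.+1) w * S t.+1 w `^ (1 - r)).
pose B := 2 + thr + \sum_(t < n) a ^+ t.+1 +
  \sum_k \sum_(t < n) 2 * q k ^+ t.+1 +
  \sum_(t < n) (2 * q0 ^+ t.+1 + 2 * expR 1 * t.+2%:R * qr ^+ t.+1).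
have gB : expectation_le P g B.
  apply: expectation_leD; first apply: expectation_leD; first apply: expectation_leD.
  - by apply: expectation_le_cst; rewrite addr_ge0.
  - by apply: expectation_le_sum => t; exact: expectation_le_indic.
  - apply: expectation_le_sum => k; apply: expectation_le_sum => t.
    by apply: expectation_leZ => //; exact: expectation_le_indic.
  - apply: expectation_le_sum => t; apply: expectation_leD.
      by apply: expectation_leZ => //; exact: expectation_le_indic.
    split.
    + apply: measurable_funM; first exact: measurable_indic.
      exact: (measurableT_comp (measurable_powR (1 - r)) (measurable_grid_wealth _ _ _)).
    + by move=> w; rewrite mulr_ge0 ?powR_ge0.
    + by apply: (expectation_grid_powR (iidX k0)) => //; rewrite r0.
have fg w : (forall k s, X k s w <= 1) ->
    (dmed_pulls r (fun k s => X k s w) n i)%:R <= g w.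
  move=> X1.
  have r01 : 0 < r < 1 by rewrite r0.
  apply: le_trans (dmed_pulls_le r01 X1 (Iopt mu) i k0 lo1 hi1 d00 n0) _.
  apply: lerD; first apply: lerD; first apply: lerD.
  - by rewrite /thr /d0 mulrA [(1 - r) * _]mulrC.
  - apply: ler_sum => t _; rewrite indicE ler_nat.
    case: (boolP (_ < _)%E) => // close.
    by rewrite mem_set//; exact: Aclose.
  - apply: ler_sum => k _; apply: ler_sum => t _; rewrite indicE.
    suff -> : (w \in U k t.+1) =
        misleading (fun k s => X k s w) (Iopt mu) (ms - delta) (mp + delta) k t.+1 by [].
    by apply/idP/idP; rewrite inE.
  - apply: ler_sum => t _; rewrite indicE -/x /S.
    have -> : (w \in U0 t.+1) = underestimated (fun k s => X k s w) k0 x t.+1.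
      by apply/idP/idP; rewrite inE.
    by rewrite mulrDr [2 * _]mulrC.
have ae1 : {ae P, forall w, forall k s, X k s w <= 1}.
  (* Countable intersections are indexed by nat, so arms are embedded in nat. *)
  pose Q m w := if insub m is Some k then forall s, X k s w <= 1 else True.
  suff : {ae P, forall w, forall m, Q m w}.
    apply: filterS => w Qw k s; have := Qw (val k).
    by rewrite /Q valK; apply.
  apply: ae_foralln => m; rewrite /Q; case: insubP => [k _ _|_].
    exact: semibounded_rewards (iidX k) (Fle1 k).
  exact: aeW.
have f0 w : 0 <= (dmed_pulls r (fun k s => X k s w) n i)%:R :> R by [].
apply: le_trans (integral_le_ae f0 ae1 fg gB) _.
rewrite lee_fin.
have sum_a := geometric_sum_le n a01.
have sum_q : \sum_k \sum_(t < n) 2 * q k ^+ t.+1 <=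
    \sum_(k in Iopt mu) K%:R / (1 - expeN (cramer (F k) (ms - delta))) +
    \sum_(k | k \notin Iopt mu) K%:R / (1 - expeN (cramer (F k) (mp + delta))).
  have -> : \sum_(k in Iopt mu) K%:R / (1 - expeN (cramer (F k) (ms - delta))) =
      \sum_(k in Iopt mu) K%:R / (1 - q k).
    by apply: eq_bigr => k kA; rewrite /q /th kA.
  have -> : \sum_(k | k \notin Iopt mu) K%:R / (1 - expeN (cramer (F k) (mp + delta))) =
      \sum_(k | k \notin Iopt mu) K%:R / (1 - q k).
    by apply: eq_bigr => k kA; rewrite /q /th (negbTE kA).
  apply: (@le_trans _ _ (\sum_k K%:R / (1 - q k))); last first.
    by rewrite (bigID (fun k => k \in Iopt mu)).
  apply: ler_sum => k _; rewrite -mulr_sumr.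
  have /andP[_ qk1] := q01 k.
  have V0 : 0 <= (1 - q k)^-1 by rewrite invr_ge0 subr_ge0 ltW.
  have := geometric_sum_le n (q01 k).
  have := ler_wpM2r V0 K2; lra.
have sum_q0 := geometric_sum_le n q001.
have sum_qr := geometric_deriv_sum_le n qr01.
have e0 : 0 < expR 1 :> R by exact: expR_gt0.
have sum_B : \sum_(t < n) (2 * q0 ^+ t.+1 + 2 * expR 1 * t.+2%:R * qr ^+ t.+1) <=
    2 * ((1 - q0)^-1 - 1) + 2 * expR 1 / (r * (1 - qr) ^+ 2).
  rewrite big_split/=; apply: lerD; first by rewrite -mulr_sumr ler_pM2l.
  under eq_bigr do rewrite -mulrA.
  rewrite -mulr_sumr ler_pM2l ?mulr_gt0//; apply: (le_trans sum_qr).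
  have /andP[_ qr1] := qr01.
  have p0 : 0 < (1 - qr) ^+ 2 by rewrite exprn_gt0// subr_gt0.
  rewrite lef_pV2 ?posrE; [by rewrite ger_pMl// ltW|exact: p0|].
  exact: mulr_gt0.
have V0 : 0 <= (1 - q0)^-1 by case/andP: q001 => _ q1; rewrite invr_ge0 subr_ge0 ltW.
have KV := ler_wpM2r V0 K2.
rewrite /B /b1 -/a -/q0 -/qr div1r.
move: sum_a sum_q sum_B KV V0; rewrite -/x.
set s1 := \sum_(t < n) a ^+ t.+1; set s2 := \sum_k _; set s3 := \sum_(t < n) (_ + _).
set s4 := \sum_(k in Iopt mu) _; set s5 := \sum_(k | _) _.
set e1 := _ / (r * _).
have -> : 2 * (1 + K%:R) / (1 - q0) = 2 * (1 - q0)^-1 + 2 * (K%:R * (1 - q0)^-1).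
  by rewrite mulrDr mulr1 mulrDl mulrA.
lra.
Qed.
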